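(* Let $k$ be a field, $n\in\mathbb{N}$, and $q_{ij}\in k$ for $i=1,2$ and $1\le j\le n$. Let $C_n$ be the commutative Hopf algebra with coproduct $\Delta=\Delta_{q_{11}\ldots q_{2n}}$ determined by the parameters $q_{ij}$. Then the graded dual $C_n^*$ is the universal enveloping algebra of the Lie algebra which as a vector space is spanned by the elements $D_t$, where $t$ is a rooted tree in $C_n$. The bracket is given by $[D_s,D_t]=D_s*D_t-D_t*D_s$, where $$D_s*D_t=\sum_{w=s\cup t}q(s,w)\,D_w ,$$ the sum ranging over all rooted trees $w$ in $C_n$ that have $s$ and $t$ as complementary colored subforests (one term for each tree $w$ and each subforest of $w$ isomorphic to $s$ whose complement is isomorphic to $t$).
   Context: A rooted tree is a finite partially ordered set with a minimal element (the root) such that $y\neq z$, $y<x$, $z<x$ imply $y<z$ or $z<y$; a forest is a finite disjoint union of rooted trees (possibly empty). Elements are vertices; $|t|$ is the number of vertices of $t$; an edge is a pair $v<w$ with nothing strictly between, and $v$ is its lower vertex. Trees and forests here have edges colored by $\{1,\ldots,n\}$ and are taken up to color-preserving isomorphism. $C_n=\mathsf{Com}[\lambda_n](0)$ is the initial unital commutative $k$-algebra equipped with a linear map $\lambda:C_n^{\otimes n}\to C_n$. Concretely, $C_n$ is the polynomial algebra on the set of rooted trees with edges colored by $\{1,\ldots,n\}$; it has as basis the forests, the product is disjoint union and the unit $1$ is the empty forest. For forests $x_1,\ldots,x_n$, $\lambda(x_1,\ldots,x_n)$ is the tree obtained from the forest $x_1\cdots x_n$ by adding a new root and connecting the root of each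 tree in $x_j$ to the new root by an edge of color $j$. Define linear maps $\sigma_1,\sigma_2:C_n^{\otimes n}\to C_n$ on forests by $\sigma_i(t_1,\ldots,t_n)=t_1\cdots t_n\cdot\prod_{j}q_{ij}^{|t_j|}$ (with $0^0=1$). The coproduct $\Delta:C_n\to C_n\otimes C_n$ is the unique unital algebra homomorphism with $$\Delta\circ\lambda=(\sigma_1\otimes\lambda+\lambda\otimes\sigma_2)\circ\tau\circ\Delta^{\otimes n},$$ where $\tau:(C_n\otimes C_n)^{\otimes n}\to C_n^{\otimes n}\otimes C_n^{\otimes n}$ collects odd-position factors on the left and even-position factors on the right; the counit is $1$ on the empty forest and $0$ on nonempty forests. This makes $C_n$ a commutative Hopf algebra, graded by the number of vertices. The graded dual is $C_n^*=\bigoplus_m((C_n)_m)^*$, a cocommutative Hopf algebra with product dual to $\Delta$ (so $(D_sD_t)(u)=(D_s\otimes D_t)(\Delta(u))$) and coproduct dual to the product of $C_n$; $\{D_u\}$, $u$ a forest, denotes the basis dual to the basis of forests. A subforest $s$ of a forest $t$ is a subset of the vertices of $t$ with the induced order; an edge $w<v$ of $s$ gets the color of that edge of $t$ with lower vertex $w$ lying on the unique path from $v$ down to $w$ in $t$. $s^c$ is the complementary subset, likewise a subforest. For $v\in s$, $p_j(v,s,t)$ is the number of edges of color $j$ on the path in $t$ from $v$ to the root of the connected component of $t$ containing $v$, that have their lower vertex in $s^c$. Finally, for a subforest $s$ of $t$, $$q(s,t)=\prod_j q_{1j}^{\sum_{v\in s}p_j(v,s,t)}\cdot\prod_j q_{2j}^{\sum_{v\in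 s^c}p_j(v,s^c,t)} ;$$ in the claim, $q(s,w)$ is evaluated at the given subforest of $w$ isomorphic to $s$.
   Formalization: That C_n^* is the universal enveloping algebra is claimed only for k of characteristic 0; in characteristic p > 0 it always fails, since D_u for u the forest of p isolated vertices is not generated by the D_t. *)

(* Defs.v *)
From HB Require Import structures.
From mathcomp Require Import all_boot ssralg generic_quotient finmap.
From mathcomp.multinomials Require Import monalg.

Set Implicit Arguments.
Unset Strict Implicit.
Unset Printing Implicit Defensive.

Import GRing.Theory.
Local Open Scope ring_scope.
Local Open Scope quotient_scope.

(* A finite poset with colored edges.  [below v w] is the strict order v < w;
   [color v w] is [Some j] when v < w is an edge of color j and [None] when
   (v, w) is not an edge (imposed in [is_forest]). *)
Record cposet (n : nat) := CPoset {
  vert :> finType;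
  below : rel vert;
  color : vert -> vert -> option 'I_n
}.

Definition covers (T : finType) (lt : rel T) : rel T :=
  fun v w => lt v w && ~~ [exists u, lt v u && lt u w].

Section Posets.
Variable n : nat.
Implicit Types P Q : cposet n.

Definition edge P : rel P := covers (@below n P).

(* A finite disjoint union of rooted trees is a finite poset in which the
   elements strictly below a given one are pairwise comparable: the component
   of x then has the minimal element below x as its root. *)
Definition is_forest P : bool :=
  [&& [forall x : P, ~~ below x x],
      [forall x : P, forall y : P, forall z : P,
         below x y ==> below y z ==> below x z],
      [forall x : P, forall y : P, forall z : P,
         (y != z) ==> below y x ==> below z x ==> below y z || below z y]
    & [forall v : P, forall w : P, isSome (color v w) == edge v w]].

Definition is_rooted P : bool :=
  [exists r : P, forall v : P, (v != r) ==> below r v].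

Definition is_iso P Q (f : P -> Q) : Prop :=
  [/\ bijective f,
      forall x y, below (f x) (f y) = below x y
    & forall x y, color (f x) (f y) = color x y].

Definition iso P Q : bool :=
  [exists f : {ffun P -> Q},
     [&& injectiveb f, #|P| == #|Q|,
         [forall x, forall y, below (f x) (f y) == below x y]
       & [forall x, forall y, color (f x) (f y) == color x y]]].

Lemma isoP P Q : reflect (exists f : P -> Q, is_iso f) (iso P Q).
Proof.
apply: (iffP existsP) => [[f /and4P[injf /eqP eqPQ lef cof]]|[f [bijf lef cof]]].
  exists f; split.
  - by apply: inj_card_bij; [apply/injectiveP | rewrite eqPQ].
  - by move=> x y; have /forallP/(_ y)/eqP := forallP lef x.
  - by move=> x y; have /forallP/(_ y)/eqP := forallP cof x.
exists [ffun x => f x]; apply/and4P; split.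
- by apply/injectiveP => x y; rewrite !ffunE; apply: bij_inj.
- by rewrite (bij_eq_card bijf).
- by apply/forallP => x; apply/forallP => y; rewrite !ffunE lef.
- by apply/forallP => x; apply/forallP => y; rewrite !ffunE cof.
Qed.

Lemma iso_refl P : iso P P.
Proof. by apply/isoP; exists id; split=> //; exists id. Qed.

Lemma iso_sym P Q : iso P Q = iso Q P.
Proof.
suff imp P' Q' : iso P' Q' -> iso Q' P' by apply/idP/idP; apply: imp.
case/isoP=> f [[g fK gK] lef cof]; apply/isoP; exists g; split.
- by exists f.
- by move=> x y; rewrite -lef !gK.
- by move=> x y; rewrite -cof !gK.
Qed.

Lemma iso_trans Q P R : iso P Q -> iso Q R -> iso P R.
Proof.
case/isoP=> f [bf lf cf] /isoP[g [bg lg cg]]; apply/isoP; exists (g \o f).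
split=> [|x y|x y] /=; [exact: bij_comp | by rewrite lg lf | by rewrite cg cf].
Qed.

Lemma is_forestP P :
  reflect [/\ irreflexive (@below n P), transitive (@below n P),
              forall x y z : P, below y x -> below z x -> y != z ->
                below y z || below z y
            & forall v w : P, isSome (color v w) = edge v w]
          (is_forest P).
Proof.
apply: (iffP and4P) => [[h1 h2 h3 h4]|[h1 h2 h3 h4]]; split.
- by move=> x; apply/negbTE; apply: (forallP h1).
- move=> y x z xy yz.
  by have /forallP/(_ y)/forallP/(_ z) := forallP h2 x; rewrite xy yz; apply.
- move=> x y z yx zx yz.
  by have /forallP/(_ y)/forallP/(_ z) := forallP h3 x; rewrite yx zx yz; apply.
- by move=> v w; have /forallP/(_ w)/eqP := forallP h4 v.
- by apply/forallP=> x; rewrite h1.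
- apply/forallP=> x; apply/forallP=> y; apply/forallP=> z.
  by apply/implyP=> xy; apply/implyP; apply: h2.
- apply/forallP=> x; apply/forallP=> y; apply/forallP=> z.
  by apply/implyP=> yz; apply/implyP=> yx; apply/implyP=> zx; exact: h3 yx zx yz.
- by apply/forallP=> x; apply/forallP=> y; rewrite h4.
Qed.

Lemma iso_forest P Q : iso P Q -> is_forest P -> is_forest Q.
Proof.
rewrite iso_sym => /isoP[g [[f gK fK] lg cg]].
have eg v w : edge (g v) (g w) = edge v w.
  rewrite /edge /covers lg; congr (_ && ~~ _); apply/existsP/existsP => [[u]|[u]].
    by rewrite -[u]fK !lg => ?; exists (f u).
  by rewrite -!lg => ?; exists (g u).
case/is_forestP=> h1 h2 h3 h4; apply/is_forestP; split.
- by move=> x; rewrite -lg.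
- by move=> y x z; rewrite -!lg; apply: h2.
- by move=> x y z; rewrite -!lg -(can_eq gK); apply: h3.
- by move=> v w; rewrite -cg -eg.
Qed.

Lemma iso_rooted P Q : iso P Q -> is_rooted P -> is_rooted Q.
Proof.
case/isoP=> f [[g fK gK] lf _] /existsP[r /forallP hr].
apply/existsP; exists (f r); apply/forallP=> v; apply/implyP=> nvr.
rewrite -[v]gK lf; apply: (implyP (hr _)); apply: contraNneq nvr => <-.
by rewrite gK.
Qed.

Lemma iso_card P Q : iso P Q -> #|P| = #|Q|.
Proof. by case/isoP=> f [/bij_eq_card]. Qed.

Definition empty_poset : cposet n :=
  @CPoset n void (fun _ _ => false) (fun _ _ => None).

Definition disj_union P Q : cposet n :=
  @CPoset n (P + Q)%type
    (fun a b => match a, b with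
       | inl v, inl w => below v w
       | inr v, inr w => below v w
       | _, _ => false
       end)
    (fun a b => match a, b with
       | inl v, inl w => color v w
       | inr v, inr w => color v w
       | _, _ => None
       end).

Lemma empty_forest : is_forest empty_poset.
Proof. by apply/is_forestP; split=> -[]. Qed.

Lemma disj_union_forest P Q :
  is_forest P -> is_forest Q -> is_forest (disj_union P Q).
Proof.
case/is_forestP=> p1 p2 p3 p4 /is_forestP[q1 q2 q3 q4]; apply/is_forestP; split.
- by case=> x /=; rewrite ?p1 ?q1.
- by case=> y [] x [] z //=; [apply: p2 | apply: q2].
- by case=> x [] y [] z //=; [apply: p3 | apply: q3].
- have ex (h : P + Q -> bool) : [exists u, h u]
      = [exists u, h (inl u)] || [exists u, h (inr u)].
    apply/existsP/orP=> [[[]u hu]|[]/existsP[u hu]].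
    + by left; apply/existsP; exists u.
    + by right; apply/existsP; exists u.
    + by exists (inl u).
    + by exists (inr u).
  have ex0 (T : finType) (h : pred T) : h =1 xpred0 -> [exists u, h u] = false.
    by move=> h0; apply/existsP=> -[u]; rewrite h0.
  case=> v [] w; rewrite /edge /covers ex //=.
  + by rewrite p4 [X in _ || X]ex0 // orbF.
  + by rewrite q4 [X in X || _]ex0.
Qed.

Lemma disj_union_iso P P' Q Q' :
  iso P P' -> iso Q Q' -> iso (disj_union P Q) (disj_union P' Q').
Proof.
case/isoP=> f [[f' fK f'K] lf cf] /isoP[g [[g' gK g'K] lg cg]].
apply/isoP; exists (fun a : P + Q => match a with
                       | inl x => inl (f x) | inr y => inr (g y) end).
split.
- exists (fun a : P' + Q' => match a with
                       | inl x => inl (f' x) | inr y => inr (g' y) end).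
  + by case=> x; rewrite ?fK ?gK.
  + by case=> x; rewrite ?f'K ?g'K.
- by case=> x [] y /=.
- by case=> x [] y /=.
Qed.

Lemma disj_unionC P Q : iso (disj_union P Q) (disj_union Q P).
Proof.
apply/isoP.
exists (fun a : P + Q => match a with inl x => inr x | inr y => inl y end).
split; [|by case=> x [] y|by case=> x [] y].
by exists (fun a : Q + P => match a with inl x => inr x | inr y => inl y end); case.
Qed.

Lemma disj_unionA P Q R :
  iso (disj_union P (disj_union Q R)) (disj_union (disj_union P Q) R).
Proof.
apply/isoP; exists (fun a : P + (Q + R) => match a with
  | inl x => inl (inl x) | inr (inl y) => inl (inr y) | inr (inr z) => inr z end).
split; [|by case=> [x|[x|x]] [y|[y|y]]|by case=> [x|[x|x]] [y|[y|y]]].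
by exists (fun a : (P + Q) + R => match a with
  | inl (inl x) => inl x | inl (inr y) => inr (inl y) | inr z => inr (inr z) end);
  [case=> [x|[x|x]] | case=> [[x|x]|x]].
Qed.

Lemma disj_union0 P : iso P (disj_union empty_poset P).
Proof.
apply/isoP; exists inr; split=> //.
by exists (fun a : void + P => match a with inr x => x | inl v => of_void P v end);
  [|case=> [[]|]].
Qed.

(* The disjoint union of the X j with a new root [None], joined to the root of
   each tree of X j by an edge of color j. *)
Definition add_root (X : 'I_n -> cposet n) : cposet n :=
  @CPoset n (option {j : 'I_n & X j})
    (fun a b => match a, b with
       | None, Some _ => true
       | Some v, Some w =>
           (tag v == tag w) && below (tagged v) (tagged_as v w)
       | _, None => false
       end)
    (fun a b => match a, b with
       | None, Some w =>
           if [forall x, ~~ below x (tagged w)] then Some (tag w) else None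
       | Some v, Some w =>
           if tag v == tag w then color (tagged v) (tagged_as v w) else None
       | _, None => None
       end).

Lemma add_root_forest (X : 'I_n -> cposet n) :
  (forall j, is_forest (X j)) -> is_forest (add_root X).
Proof.
move=> hX.
have h1 j : irreflexive (@below n (X j)) by have /is_forestP[] := hX j.
have h2 j : transitive (@below n (X j)) by have /is_forestP[] := hX j.
have h3 j (x y z : X j) : below y x -> below z x -> y != z ->
    below y z || below z y by have /is_forestP[_ _ + _] := hX j; apply.
have h4 j (v w : X j) : isSome (color v w) = edge v w.
  by have /is_forestP[_ _ _] := hX j; apply.
apply/is_forestP; split.
- by case=> [[j x]|] //=; rewrite tagged_asE h1 andbF.
- case=> [[j y]|] [[i x]|] [[l z]|] //= /andP[/eqP eij] + /andP[/eqP ejl].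
  by subst; rewrite eqxx !tagged_asE; apply: h2.
- case=> [[j x]|] [[i y]|] [[l z]|] //= /andP[/eqP eij] + /andP[/eqP ejl].
  subst; rewrite eqxx !tagged_asE => yx zx.
  move=> nyz; apply: h3 yx zx _; apply: contraNneq nyz => ->; exact: eqxx.
- case=> [[j x]|] [[i y]|] //=; rewrite /edge /covers /=.
  + have [eij|] //= := eqVneq j i; subst.
    rewrite tagged_asE h4 /edge /covers; congr (_ && ~~ _).
    apply/existsP/existsP=> [[u]|[[[l u]|]]] //=.
      by exists (Some (Tagged X u)); rewrite /= !eqxx !tagged_asE.
    case/andP=> /andP[/eqP ejl]; subst.
    by rewrite !tagged_asE => xu /andP[_ uy]; exists u; rewrite xu.
  + case: ifP => [/forallP hy|/negbT]; rewrite /=.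
      apply/esym/existsP=> -[[[l u]|]] //= /andP[/eqP ejl].
      by subst; rewrite tagged_asE (negbTE (hy _)).
    rewrite negb_forall => /existsP[u]; rewrite negbK => uy.
    apply/esym/negbTE; rewrite negbK; apply/existsP; exists (Some (Tagged X u)).
    by rewrite /= eqxx tagged_asE.
Qed.

Definition induced_below P (A : {set P}) : rel {v : P | v \in A} :=
  fun v w => below (val v) (val w).

(* The subforest of P on the vertex set A.  The edge v < w of the subforest
   takes the color of the edge v < c of P with c on the path from v to w. *)
Definition subforest P (A : {set P}) : cposet n :=
  @CPoset n {v : P | v \in A} (@induced_below P A)
    (fun v w =>
       if covers (@induced_below P A) v w then
         if [pick c : P | edge (val v) c && ((c == val w) || below c (val w))]
           is Some c then color (val v) c else None
       else None).

Lemma subforest_forest P (A : {set P}) : is_forest P -> is_forest (subforest A).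
Proof.
case/is_forestP=> h1 h2 h3 h4; apply/is_forestP; split.
- by move=> x; apply: h1.
- by move=> y x z; apply: h2.
- by move=> x y z yx zx nyz; apply: (h3 (val x)).
- move=> v w; rewrite /edge /=; case: ifP => // /andP[vw _]; case: pickP => [c|].
    by case/andP=> + _; rewrite h4.
  have vP : below (val v) (val w) && ((val w == val w) || below (val w) (val w)).
    by rewrite eqxx andbT; apply: vw.
  pose m (c : P) := #|[set u | below u c]|.
  pose Pc := [pred c : P | below (val v) c && ((c == val w) || below c (val w))].
  have [c /andP[vc cw] cmin] := @arg_minnP P (val w) Pc m vP.
  move/(_ c); rewrite cw andbT /edge /covers vc /=.
  move=> /negbFE/existsP[u] /andP[vu uc].
  have /cmin : Pc u.
    rewrite /Pc /= vu; case/orP: cw => [/eqP <-|cw]; rewrite ?uc ?orbT //.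
    by rewrite (h2 _ _ _ uc cw) orbT.
  rewrite leqNgt => /negP[]; apply: proper_card; apply/properP; split.
    by apply/subsetP=> z; rewrite !inE => zu; apply: h2 zu uc.
  by exists u; rewrite inE ?uc // h1.
Qed.

(* p_j(v, s, t), for t = P and s the subforest on A. *)
Definition npath P (A : {set P}) (j : 'I_n) (v : P) : nat :=
  #|[set e : P * P | [&& edge e.1 e.2, (e.2 == v) || below e.2 v,
                         color e.1 e.2 == Some j & e.1 \notin A]]|.

Definition qweight (k : nzRingType) (q1 q2 : 'I_n -> k) P (A : {set P}) : k :=
  (\prod_(j < n) q1 j ^+ (\sum_(v in A) npath A j v)) *
  (\prod_(j < n) q2 j ^+ (\sum_(v in ~: A) npath (~: A) j v)).

End Posets.

Section Forests.
Variable n : nat.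

(* Finite codes for posets on 'I_m, so that isomorphism classes form a type. *)
Definition poset_code : Type :=
  {m : nat & {ffun 'I_m * 'I_m -> bool} * {ffun 'I_m * 'I_m -> option 'I_n}}%type.

HB.instance Definition _ := Choice.on poset_code.

Definition decode (c : poset_code) : cposet n :=
  @CPoset n 'I_(tag c) (fun v w => (tagged c).1 (v, w))
                       (fun v w => (tagged c).2 (v, w)).

Definition encode (P : cposet n) : poset_code :=
  Tagged (fun m => {ffun 'I_m * 'I_m -> bool} *
                   {ffun 'I_m * 'I_m -> option 'I_n})%type
    ([ffun e : 'I_#|P| * 'I_#|P| => below (enum_val e.1) (enum_val e.2)],
     [ffun e : 'I_#|P| * 'I_#|P| => color (enum_val e.1) (enum_val e.2)]).

Lemma encodeK P : iso P (decode (encode P)).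
Proof.
rewrite iso_sym; apply/isoP; exists (enum_val : 'I_#|P| -> P).
by split=> [|x y|x y]; [apply: enum_val_bij | rewrite /= ffunE | rewrite /= ffunE].
Qed.

Definition forest_code := {c : poset_code | is_forest (decode c)}.

HB.instance Definition _ := Choice.on forest_code.

Definition forest_iso : rel forest_code :=
  fun c d => iso (decode (val c)) (decode (val d)).

Lemma forest_iso_equiv : equiv_class_of forest_iso.
Proof.
split=> [c|c d|d c e]; [exact: iso_refl | exact: iso_sym | exact: iso_trans].
Qed.

Canonical forest_iso_equiv_rel := EquivRelPack forest_iso_equiv.

(* Forests with edges colored by 'I_n, up to color-preserving isomorphism. *)
Definition forest := {eq_quot forest_iso}.

HB.instance Definition _ := Choice.on forest.

Definition poset_of (u : forest) : cposet n := decode (val (repr u)).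

Lemma poset_ofP u : is_forest (poset_of u).
Proof. exact: (valP (repr u)). Qed.

Lemma encode_forest P : is_forest P -> is_forest (decode (encode P)).
Proof. exact/iso_forest/encodeK. Qed.

Definition class (P : cposet n) (hP : is_forest P) : forest :=
  \pi_forest (exist _ (encode P) (encode_forest hP) : forest_code).

Lemma classK P (hP : is_forest P) : iso (poset_of (class hP)) P.
Proof.
rewrite iso_sym; apply: (iso_trans (encodeK P)).
rewrite /poset_of /class; case: piP => c /eqmodP; exact.
Qed.

Lemma poset_of_inj u v : iso (poset_of u) (poset_of v) -> u = v.
Proof. by move=> uv; rewrite -[u]reprK -[v]reprK; apply/eqmodP. Qed.

Lemma class_eq P Q (hP : is_forest P) (hQ : is_forest Q) :
  iso P Q -> class hP = class hQ.
Proof.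
move=> PQ; apply: poset_of_inj; apply: iso_trans (classK hP) _.
by apply: iso_trans PQ _; rewrite iso_sym classK.
Qed.

Definition nvert (u : forest) : nat := #|poset_of u|.

Definition fempty : forest := class (empty_forest n).

Definition funion (u v : forest) : forest :=
  class (disj_union_forest (poset_ofP u) (poset_ofP v)).

Lemma funionE u v :
  iso (poset_of (funion u v)) (disj_union (poset_of u) (poset_of v)).
Proof. exact: classK. Qed.

Lemma funionC : commutative funion.
Proof. by move=> u v; apply/class_eq/disj_unionC. Qed.

Lemma funionA : associative funion.
Proof.
move=> u v w; apply: class_eq.
apply: iso_trans (disj_union_iso (iso_refl _) (funionE v w)) _.
apply: iso_trans (disj_unionA _ _ _) _.
by apply: disj_union_iso (iso_refl _); rewrite iso_sym funionE.
Qed.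

Lemma fempty_union : left_id fempty funion.
Proof.
move=> u; apply: poset_of_inj; apply: iso_trans (funionE _ _) _.
rewrite iso_sym; apply: iso_trans (disj_union0 _) _.
by apply: disj_union_iso (iso_refl _); rewrite iso_sym classK.
Qed.

Lemma funion_empty : right_id fempty funion.
Proof. by move=> u; rewrite funionC fempty_union. Qed.

Lemma nvert_union u v : nvert (funion u v) = (nvert u + nvert v)%N.
Proof. by rewrite /nvert (iso_card (funionE u v)) card_sum. Qed.

Lemma nvert_eq0 u : nvert u = 0%N -> u = fempty.
Proof.
move=> u0; apply: poset_of_inj; rewrite iso_sym.
apply: iso_trans (classK _) _; apply/isoP.
exists (fun v : void => of_void (poset_of u) v); split; try by case.
have h (x : poset_of u) : False.
  by have := card0_eq u0 x; rewrite inE.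
by exists (fun x => match h x with end) => [[]|x]; case: (h x).
Qed.

Lemma funion_eq_empty u v : funion u v = fempty -> u = fempty /\ v = fempty.
Proof.
move/(congr1 nvert); rewrite nvert_union {3}/nvert (iso_card (classK _)) card_void.
by case: (nvert u) (@nvert_eq0 u) (nvert v) (@nvert_eq0 v) => [|//] -> // [|//] ->.
Qed.

HB.instance Definition _ := Choice_isMonomialDef.Build forest
  funionA fempty_union funion_empty funion_eq_empty.
HB.instance Definition _ := MonomialDef_isConomialDef.Build forest funionC.

End Forests.

Section ProductMonoid.
Variables A B : monomType.

Definition pmul (x y : A * B) : A * B := (mmul x.1 y.1, mmul x.2 y.2).
Definition pone : A * B := (mone, mone).

Lemma pmulA : associative pmul.
Proof. by move=> [a b] [c d] [e f]; rewrite /pmul /= !mulmA. Qed.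
Lemma pmul1m : left_id pone pmul.
Proof. by move=> [a b]; rewrite /pmul /= !mul1m. Qed.
Lemma pmulm1 : right_id pone pmul.
Proof. by move=> [a b]; rewrite /pmul /= !mulm1. Qed.
Lemma punitm x y : pmul x y = pone -> x = pone /\ y = pone.
Proof.
by case: x y => [a b] [c d] [/unitm[-> ->] /unitm[-> ->]].
Qed.

HB.instance Definition _ := Choice_isMonomialDef.Build (A * B)%type
  pmulA pmul1m pmulm1 punitm.
End ProductMonoid.

HB.instance Definition _ (A B : conomType) :=
  MonomialDef_isConomialDef.Build (A * B)%type
    (fun x y : A * B => congr2 pair (mulmC x.1 y.1) (mulmC x.2 y.2)).

Section Trees.
Variable n : nat.

Definition tree := {t : forest n | is_rooted (poset_of t)}.

HB.instance Definition _ := Choice.on tree.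

Definition forest_of_tree (t : tree) : forest n := val t.
Coercion forest_of_tree : tree >-> forest.

Definition add_root_forests (x : {ffun 'I_n -> forest n}) : forest n :=
  class (add_root_forest (fun j => poset_ofP (x j))).

Definition forests_of (m : nat) : seq (forest n) :=
  undup [seq \pi_(forest n) c | c <- pmap insub
    [seq Tagged (fun m => {ffun 'I_m * 'I_m -> bool} *
                          {ffun 'I_m * 'I_m -> option 'I_n})%type x
    | x <- enum {: {ffun 'I_m * 'I_m -> bool} *
                   {ffun 'I_m * 'I_m -> option 'I_n}}] : seq (forest_code n)].

Definition trees_of (m : nat) : seq tree := pmap insub (forests_of m).

Lemma mem_forests_of m u : (u \in forests_of m) = (nvert u == m).
Proof.
rewrite mem_undup; apply/mapP/eqP => [[c + ->]|<-].
  rewrite mem_pmap_sub => /mapP[x _ cE].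
  have -> : m = #|decode (val c)| by rewrite cE card_ord.
  apply: iso_card; rewrite /poset_of; case: piP => d /eqmodP.
  by rewrite /= /forest_iso iso_sym.
exists (repr u); last by rewrite reprK.
rewrite mem_pmap_sub /nvert /poset_of; case: (val (repr u)) => [m' x] /=.
by rewrite card_ord map_f // mem_enum.
Qed.

Lemma forests_of_uniq m : uniq (forests_of m).
Proof. exact: undup_uniq. Qed.

Lemma mem_trees_of m (t : tree) : (t \in trees_of m) = (nvert t == m).
Proof. by rewrite mem_pmap_sub mem_forests_of. Qed.

Lemma trees_of_uniq m : uniq (trees_of m).
Proof. exact/pmap_sub_uniq/forests_of_uniq. Qed.

End Trees.

(* {malg k[K]} is the free k-module on K, and {malg k[(K * L)%type]} and
   {malg k[{ffun 'I_n -> K}]} are the tensor product of two free modules and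
   the n-th tensor power of a free module. *)
Section FreeModules.
Variables (k : fieldType) (n : nat).
Implicit Types K L : choiceType.

Lemma malg_scaleU K (c : k) (u : K) : << c *g u >> = c *: << u >> :> {malg k[K]}.
Proof. by apply/malgP=> v; rewrite mcoeffZ !mcoeffU mulr_natr. Qed.

Definition linext K (V : lmodType k) (f : K -> V) (x : {malg k[K]}) : V :=
  \sum_(u <- msupp x) x@_u *: f u.

Definition tensor K L (x : {malg k[K]}) (y : {malg k[L]}) : {malg k[(K * L)%type]} :=
  \sum_(a <- msupp x) \sum_(b <- msupp y) (x@_a * y@_b) *: << (a, b) >>.

Definition ntensor K (y : 'I_n -> {malg k[K]}) : {malg k[{ffun 'I_n -> K}]} :=
  \sum_(z : {ffun 'I_n -> (\bigcup_(j <- enum 'I_n) msupp (y j))%fset})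
    (\prod_(j < n) (y j)@_(val (z j))) *: << [ffun j => val (z j)] >>.

Lemma linext_basis K (V : lmodType k) (f : K -> V) u : linext f << u >> = f u.
Proof. by rewrite /linext msuppU oner_eq0 big_seq_fset1 mcoeffUU scale1r. Qed.

Lemma mcoeff_tensor K L (x : {malg k[K]}) (y : {malg k[L]}) a b :
  (tensor x y)@_((a, b) : K * L) = x@_a * y@_b.
Proof.
rewrite /tensor raddf_sum /= [in RHS](monalgE x) [in RHS](monalgE y) !raddf_sum /=.
rewrite mulr_suml; apply: eq_bigr => c _; rewrite raddf_sum mulr_sumr.
apply: eq_bigr => d _; rewrite /= mcoeffZ !mcoeffU xpair_eqE.
by case: eqP; case: eqP; rewrite ?mulr1n ?mulr0n ?mulr0 ?mul0r ?mulr1.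
Qed.

Lemma mcoeff_ntensor K (y : 'I_n -> {malg k[K]}) (z : {ffun 'I_n -> K}) :
  (ntensor y)@_z = \prod_(j < n) (y j)@_(z j).
Proof.
rewrite /ntensor; set E := (\bigcup_(j <- _) _)%fset; rewrite raddf_sum /=.
have yE j a : a \in msupp (y j) -> a \in E.
  by move=> aj; apply/bigfcupP; exists j; rewrite // mem_enum.
have [/forallP zE|/forallPn[j zE]] := boolP [forall j, z j \in E].
  pose z' : {ffun 'I_n -> E} := [ffun j => FSetSub (zE j)].
  rewrite (bigD1 z') //= mcoeffZ mcoeffU.
  have -> : [ffun j => val (z' j)] = z by apply/ffunP=> j; rewrite !ffunE.
  rewrite eqxx mulr1 [X in _ + X]big1 ?addr0; last first.
    move=> w wz; rewrite mcoeffZ mcoeffU; case: eqP; rewrite ?mulr0 // => wE.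
    case/eqP: wz; apply/ffunP=> j; apply: val_inj; rewrite ffunE /=.
    by rewrite -[in RHS]wE ffunE.
  by apply: eq_bigr => j _; rewrite ffunE.
rewrite [RHS](bigD1 j) //= [X in _ = X * _]mcoeff_outdom ?mul0r; last first.
  exact: contra (@yE j _) zE.
apply: big1 => w _; rewrite mcoeffZ mcoeffU; case: eqP; rewrite ?mulr0 // => wE.
by case/negP: zE; rewrite -wE ffunE; apply: valP.
Qed.

Definition map_tensor K L K' L'
    (f : {malg k[K]} -> {malg k[K']}) (g : {malg k[L]} -> {malg k[L']}) :
    {malg k[(K * L)%type]} -> {malg k[(K' * L')%type]} :=
  linext (fun ab => tensor (f << ab.1 >>) (g << ab.2 >>)).

Definition map_ntensor K L (f : {malg k[K]} -> {malg k[L]}) :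
    {malg k[{ffun 'I_n -> K}]} -> {malg k[{ffun 'I_n -> L}]} :=
  linext (fun x : {ffun 'I_n -> K} => ntensor (fun j => f << x j >>)).

Definition tau K :
    {malg k[{ffun 'I_n -> (K * K)%type}]} ->
    {malg k[({ffun 'I_n -> K} * {ffun 'I_n -> K})%type]} :=
  linext (fun z : {ffun 'I_n -> (K * K)%type} =>
      << ([ffun j => (z j).1], [ffun j => (z j).2]) >>).

End FreeModules.

Notation Ctrees k n := {malg k[forest n]}.
Notation Ctrees2 k n := {malg k[(forest n * forest n)%type]}.
Notation Ctrees_pow k n := {malg k[{ffun 'I_n -> forest n}]}.

(* There are finitely many forests with m vertices, so the graded dual of
   [Ctrees k n] is the free module on the dual basis D_u; see [pairing_dual],
   [pairing_inj] and [pairing_surj].  Only this module structure is used, not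
   the product of the monoid algebra. *)
Notation Cdual k n := {malg k[forest n]}.

(* The vector space with basis the D_t, t a tree. *)
Notation treeL k n := {malg k[tree n]}.

Section HopfAlgebra.
Variables (k : fieldType) (n : nat).

Definition lambda : Ctrees_pow k n -> Ctrees k n :=
  linext (fun x => << add_root_forests x >>).

Definition sigma (q : 'I_n -> k) : Ctrees_pow k n -> Ctrees k n :=
  linext (fun t : {ffun 'I_n -> forest n} =>
    (\prod_(j < n) q j ^+ nvert (t j)) *: (\prod_(j < n) << t j >>)).

Definition is_coproduct (q1 q2 : 'I_n -> k)
    (Delta : {lrmorphism Ctrees k n -> Ctrees2 k n}) :=
  forall x : Ctrees_pow k n,
    let y := tau (map_ntensor Delta x) in
    Delta (lambda x) =
      map_tensor (sigma q1) lambda y + map_tensor lambda (sigma q2) y.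

Definition counit (x : Ctrees k n) : k := x@_(fempty n).

Definition Dbasis (u : forest n) : Cdual k n := << u >>.

Definition pairing (f : Cdual k n) (x : Ctrees k n) : k :=
  \sum_(u <- msupp x) x@_u * f@_u.

Definition pairing2 (f g : Cdual k n) (z : Ctrees2 k n) : k :=
  \sum_(ab <- msupp z) z@_ab * (f@_ab.1 * g@_ab.2).

Lemma pairing_basis (f : Cdual k n) u : pairing f << u >> = f@_u.
Proof.
by rewrite /pairing msuppU oner_eq0 big_seq_fset1 mcoeffUU mul1r.
Qed.

Lemma pairing_dual u v : pairing (Dbasis u) << v >> = (u == v)%:R.
Proof. by rewrite pairing_basis mcoeffU. Qed.

Lemma pairing_inj f g : pairing f =1 pairing g -> f = g.
Proof. by move=> fg; apply/malgP=> u; rewrite -!pairing_basis fg. Qed.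

Lemma pairing_surj (f : {linear Ctrees k n -> k^o}) N :
  (forall u, (N < nvert u)%N -> f << u >> = 0) ->
  exists g : Cdual k n, forall x, pairing g x = f x.
Proof.
move=> fN; have fZ c (y : Ctrees k n) : f (c *: y) = c * f y by exact: linearZ.
pose E := seq_fset tt (flatten [seq forests_of n m | m <- iota 0 N.+1]).
exists [malg u in E => f << u >>] => x.
rewrite [in RHS](monalgE x) raddf_sum; apply: eq_bigr => u _.
rewrite malg_scaleU [RHS]fZ mcoeffE seq_fsetE; case: ifPn => // uE; rewrite fN //.
rewrite ltnNge; apply: contra uE => uN; apply/flatten_mapP.
by exists (nvert u); rewrite ?mem_iota ?mem_forests_of.
Qed.

Definition is_dual_product (Delta : Ctrees k n -> Ctrees2 k n)
    (mul : Cdual k n -> Cdual k n -> Cdual k n) :=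
  forall f g x, pairing (mul f g) x = pairing2 f g (Delta x).

(* Primitivity for the coproduct of Cdual dual to the product of Ctrees. *)
Definition is_primitive (f : Cdual k n) :=
  forall x y : Ctrees k n,
    pairing f (x * y) = pairing f x * counit y + counit x * pairing f y.

Definition incl : treeL k n -> Cdual k n := linext (fun t : tree n => Dbasis t).

Variables q1 q2 : 'I_n -> k.

(* The trees w with a subforest s whose complement is t have |s| + |t| vertices. *)
Definition star (s t : tree n) : treeL k n :=
  \sum_(w <- trees_of n (nvert s + nvert t))
    (\sum_(A : {set poset_of w} | iso (subforest A) (poset_of s) &&
                                  iso (subforest (~: A)) (poset_of t))
       qweight q1 q2 A) *: << w >>.

Definition bracket (x y : treeL k n) : treeL k n :=
  linext (fun s => linext (fun t => star s t - star t s) y) x.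

End HopfAlgebra.

Section Enveloping.
Variable k : fieldType.

(* The products below are explicit arguments, as [Cdual k n] carries one that
   depends on the coproduct of [Ctrees k n]. *)
Definition is_bilinear (U V W : lmodType k) (b : U -> V -> W) : Prop :=
  (forall v, linear (b^~ v)) /\ (forall u, linear (b u)).

Definition is_lie_algebra (G : lmodType k) (br : G -> G -> G) : Prop :=
  [/\ is_bilinear br, forall x, br x x = 0
    & forall x y z, br x (br y z) + br y (br z x) + br z (br x y) = 0].

Definition is_algebra (U : lmodType k) (mul : U -> U -> U) (one : U) : Prop :=
  [/\ is_bilinear mul, associative mul, left_id one mul & right_id one mul].

Definition is_lie_map (G U : lmodType k) (br : G -> G -> G) (mul : U -> U -> U)
    (f : G -> U) : Prop :=
  linear f /\ forall x y, f (br x y) = mul (f x) (f y) - mul (f y) (f x).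

Definition is_algebra_map (U : lmodType k) (mul : U -> U -> U) (one : U)
    (A : algType k) (f : U -> A) : Prop :=
  [/\ linear f, forall x y, f (mul x y) = f x * f y & f one = 1].

Definition is_enveloping_algebra (G U : lmodType k) (br : G -> G -> G)
    (mul : U -> U -> U) (one : U) (i : G -> U) : Prop :=
  [/\ is_algebra mul one, is_lie_map br mul i
    & forall (A : algType k) (phi : G -> A), is_lie_map br *%R phi ->
        exists Phi : U -> A,
          [/\ is_algebra_map mul one Phi, forall x, Phi (i x) = phi x
            & forall Psi : U -> A, is_algebra_map mul one Psi ->
                (forall x, Psi (i x) = phi x) -> Psi =1 Phi]].

End Enveloping.

(* Main.v *)
Require Import Defs.
From HB Require Import structures.
From mathcomp Require Import all_boot ssralg finmap.
From mathcomp.multinomials Require Import monalg.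

Set Implicit Arguments.
Unset Strict Implicit.
Unset Printing Implicit Defensive.

Import GRing.Theory.
Local Open Scope ring_scope.


(** Let [pcol v w] be the color of the edge with lower vertex [v] on the path from
    [w] down to [v].  It determines the order and the edge colors of a forest, and
    it passes to subforests by restriction.  The weight of a vertex set [A] is the
    product, over all pairs of vertices [w] below [v] on different sides of [A], of
    the parameter of color [pcol w v], taken from [q1] if [v] lies in [A] and from
    [q2] otherwise ([qweightE]).  Everything about the coproduct follows from this
    pairwise form of the weight.

    The coproduct of a forest is the sum of q(A) A (x) A^c over its vertex sets
    [A].  This is multiplicative because vertices of different components do not
    interact.  It satisfies the recursion because a vertex set of a tree amounts to
    vertex sets of the branches and a decision on the root, and the root meets every
    vertex of branch [j] with color [j] ([Delta_is_coproduct]).  The recursion has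
    no other multiplicative solution, as each nonempty forest is a product of trees
    and each tree is obtained by adding a root to smaller forests
    ([coproduct_uniq]).  The dual product is therefore given by the same sum, and it
    is associative because cutting a forest into three parts in two ways weighs
    each pair of vertices once ([biweight_assoc]).

    For trees [s] and [t], the product D_s D_t agrees with D_s * D_t on trees.  On
    any other forest a vertex set and its complement can only be both trees if they
    are the two components; then the weight is 1 and the value is symmetric in [s]
    and [t] ([mul_tree_comm]).  So the inclusion of the span of trees turns the
    bracket into the commutator, and as it is injective the Jacobi identity comes
    from associativity.  Its image is primitive because a tree is not a product.

    For the universal property, let [W u] be the product, in the dual, of the D_t
    for the components [t] of [u] in some order.  On forests with at least as many
    components as [u], it is zero except at [u] itself, where it is a positive
    integer ([mcoeff_word]).  In characteristic 0 the [W u] thus form a basis, by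
    triangularity in the number of components.  In any associative algebra that
    receives the Lie algebra, each word in images of trees is a combination of words
    in the fixed orders, since exchanging two letters costs a bracket
    ([word_canonical]).  Applied to the product of the dual with a given algebra
    [A], this shows that the value of a word in [A] depends only on its value in the
    dual, which yields the algebra map ([extend_word]). *)

(** * Path colors *)

Section PathColor.
Variable n : nat.
Implicit Types P Q R : cposet n.

Definition first_step P (v w : P) : pred P :=
  fun c => edge v c && ((c == w) || below c w).

(** The color of the edge with lower vertex [v] on the path from [w] down to
    [v], and [None] when [v] does not lie below [w].  Both the order and the
    edge colors of a forest can be read off from it, and, unlike the edge
    colors, it passes to subforests by mere restriction. *)
Definition pcol P (v w : P) : option 'I_n :=
  if [pick c | first_step v w c] is Some c then color v c else None.

Lemma first_step_exists P (v w : P) :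
  is_forest P -> below v w -> exists c, first_step v w c.
Proof.
case/is_forestP=> h1 h2 _ _ vw.
pose m (c : P) := #|[set u | below u c]|.
pose Pc := [pred c : P | below v c && ((c == w) || below c w)].
have vP : Pc w by rewrite /Pc /= vw eqxx.
have [c /andP[vc cw] cmin] := @arg_minnP P w Pc m vP.
exists c; rewrite /first_step cw andbT /edge /covers vc /=.
apply/negP=> /existsP[u /andP[vu uc]].
have /cmin : Pc u.
  rewrite /Pc /= vu; case/orP: cw => [/eqP <-|cw]; rewrite ?uc ?orbT //.
  by rewrite (h2 _ _ _ uc cw) orbT.
rewrite leqNgt => /negP[]; apply: proper_card; apply/properP; split.
  by apply/subsetP=> z; rewrite !inE => zu; apply: h2 zu uc.
by exists u; rewrite inE ?uc // h1.
Qed.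

(** The vertices below [w] form a chain, so only one of them covers [v]. *)
Lemma first_step_uniq P (v w c d : P) :
  is_forest P -> first_step v w c -> first_step v w d -> c = d.
Proof.
case/is_forestP=> h1 h2 h3 _ /andP[/andP[vc /existsPn nc] cw].
case/andP=> /andP[vd /existsPn nd] dw.
have no x y : below v x -> (forall z, ~~ (below v z && below z y)) ->
    ~~ below x y by move=> vx /(_ x); rewrite vx.
apply/eqP; apply: contraT => ncd.
have: below c d || below d c.
  case/orP: cw dw => [/eqP cE|cw] /orP[/eqP dE|dw].
  - by rewrite cE dE eqxx in ncd.
  - by rewrite cE dw orbT.
  - by rewrite dE cw.
  - exact: h3 cw dw ncd.
by rewrite (negbTE (no _ _ vc nd)) (negbTE (no _ _ vd nc)).
Qed.

Lemma pcolE P (v w c : P) :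
  is_forest P -> first_step v w c -> pcol v w = color v c.
Proof.
move=> hP sc; rewrite /pcol; case: pickP => [d sd|/(_ c)]; last by rewrite sc.
by rewrite (first_step_uniq hP sc sd).
Qed.

Lemma pcol_isSome P (v w : P) : is_forest P -> isSome (pcol v w) = below v w.
Proof.
move=> hP; have /is_forestP[_ h2 _ h4] := hP.
apply/idP/idP=> [|vw].
  rewrite /pcol; case: pickP => // c /andP[/andP[vc _] /orP[/eqP <- //|cw] _].
  exact: h2 vc cw.
have [c sc] := first_step_exists hP vw.
by rewrite (pcolE hP sc) h4; case/andP: sc.
Qed.

Lemma pcol_None P (v w : P) :
  is_forest P -> (pcol v w == None) = ~~ below v w.
Proof. by move=> hP; rewrite -(pcol_isSome _ _ hP); case: pcol. Qed.

Lemma color_pcol P (v w : P) :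
  is_forest P -> color v w = if edge v w then pcol v w else None.
Proof.
move=> hP; have /is_forestP[_ _ _ h4] := hP.
case: ifP => [e|]; last by rewrite -h4; case: color.
by rewrite (pcolE (c := w) hP) // /first_step e eqxx.
Qed.

(** The paths from [c] and from [w] down to [v] leave [v] by the same edge. *)
Lemma pcol_mid P (v c w : P) :
  is_forest P -> below v c -> below c w -> pcol v w = pcol v c.
Proof.
move=> hP vc cw; have /is_forestP[_ h2 _ _] := hP.
have [d sd] := first_step_exists hP vc; rewrite (pcolE hP sd); apply: pcolE => //.
case/andP: sd => vd dc; rewrite /first_step vd /=.
case/orP: dc => [/eqP ->|dc]; first by rewrite cw orbT.
by rewrite (h2 _ _ _ dc cw) orbT.
Qed.

(** A color-preserving isomorphism onto the induced subforest on the image; the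
    order is preserved too, as [pcol] determines it. *)
Definition emb P Q (f : P -> Q) : Prop :=
  injective f /\ forall x y, pcol (f x) (f y) = pcol x y.

Lemma emb_below P Q (f : P -> Q) x y :
  is_forest P -> is_forest Q -> emb f -> below (f x) (f y) = below x y.
Proof. by move=> hP hQ [_ fp]; rewrite -!pcol_isSome ?fp. Qed.

(** A pair without a path has no path color on either side, and for the others the
    path color is the color of the first step. *)
Lemma emb_first_step P Q (f : P -> Q) :
  is_forest P -> is_forest Q -> injective f ->
  (forall x y, below (f x) (f y) = below x y) ->
  (forall x y c, first_step x y c -> below x c ->
     pcol (f x) (f y) = color x c) ->
  emb f.
Proof.
move=> hP hQ fi lf cf; split=> // x y.
case xy: (below x y); last first.
  have /eqP -> : pcol x y == None by rewrite pcol_None ?xy.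
  by apply/eqP; rewrite pcol_None // lf xy.
have [c sc] := first_step_exists hP xy; rewrite (pcolE hP sc); apply: cf => //.
by case/andP: sc => /andP[].
Qed.

Lemma iso_emb P Q (f : P -> Q) :
  is_forest P -> is_iso f -> emb f.
Proof.
move=> hP [bf lf cf].
have hQ : is_forest Q by apply: iso_forest hP; apply/isoP; exists f.
apply: emb_first_step => // [|x y c sc _]; first exact: bij_inj.
have [g fK gK] := bf; rewrite (pcolE (c := f c) hQ) //.
case/andP: sc; rewrite /first_step /edge /covers !lf (bij_eq bf).
case/andP=> -> nu ->; rewrite andbT /=.
apply: contra nu => /existsP[u]; rewrite -[u]gK !lf => ?.
by apply/existsP; exists (g u).
Qed.

Lemma emb_iso P Q (f : P -> Q) :
  is_forest P -> is_forest Q -> emb f -> bijective f -> iso P Q.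
Proof.
move=> hP hQ ef bf; apply/isoP; exists f.
have lf x y : below (f x) (f y) = below x y by apply: emb_below.
split=> // x y; rewrite !color_pcol //; case: ef => _ ->; congr (if _ then _ else _).
have [g fK gK] := bf; rewrite /edge /covers lf; congr (_ && ~~ _).
apply/existsP/existsP=> [[u]|[u]].
  by rewrite -[u]gK !lf => ?; exists (g u).
by rewrite -!lf => ?; exists (f u).
Qed.

Lemma emb_comp P Q R (f : P -> Q) (g : Q -> R) : emb f -> emb g -> emb (g \o f).
Proof.
by move=> [fi fp] [gi gp]; split=> [|x y] /=; [apply: inj_comp | rewrite gp].
Qed.

Lemma emb_val P (A : {set P}) :
  is_forest P -> emb (val : subforest A -> P).
Proof.
move=> hP; apply: emb_first_step => //; first exact: subforest_forest.
  exact: val_inj.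
move=> x y c /andP[xc cy] lxc.
have -> : color x c = pcol (val x) (val c).
  by rewrite /= ifT // /pcol /first_step.
by case/orP: cy => [/eqP -> //|cy]; apply: pcol_mid.
Qed.

(** ** Path colors of disjoint unions and of trees *)

Lemma emb_inl P Q : is_forest P -> is_forest Q ->
  emb (inl : P -> disj_union P Q).
Proof.
move=> hP hQ; have hU := disj_union_forest hP hQ.
apply: emb_first_step => // [x y [] //|x y c /andP[/andP[_ nu] cy] xc].
apply: (@pcolE (disj_union P Q) (inl x) (inl y) (inl c)) => //.
rewrite /first_step /edge /covers /= xc /= [_ == inl y]/(_ == _) /= cy andbT.
by apply: contra nu => /existsP[[] u //= xuc]; apply/existsP; exists u.
Qed.

Lemma emb_inr P Q : is_forest P -> is_forest Q ->
  emb (inr : Q -> disj_union P Q).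
Proof.
move=> hP hQ; have hU := disj_union_forest hP hQ.
apply: emb_first_step => // [x y [] //|x y c /andP[/andP[_ nu] cy] xc].
apply: (@pcolE (disj_union P Q) (inr x) (inr y) (inr c)) => //.
rewrite /first_step /edge /covers /= xc /= [_ == inr y]/(_ == _) /= cy andbT.
by apply: contra nu => /existsP[[] u //= xuc]; apply/existsP; exists u.
Qed.

Section AddRoot.
Variables (X : 'I_n -> cposet n) (hX : forall j, is_forest (X j)).

Definition branch j (x : X j) : add_root X := Some (Tagged X x).

Lemma emb_branch j : emb (@branch j).
Proof.
have hU := add_root_forest hX.
have lE u v : below (@branch j u) (branch v) = below u v.
  by rewrite /= eqxx tagged_asE.
have inj : injective (@branch j).
  by move=> x y [] /eqP; rewrite eq_Tagged => /eqP.
apply: emb_first_step => // x y c /andP[/andP[_ nu] cy] xc.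
rewrite (pcolE (c := branch c) hU); first by rewrite /= eqxx tagged_asE.
rewrite /first_step /edge /covers !lE xc (inj_eq inj) cy andbT.
apply: contra nu => /existsP[[[i u]|//]] /=.
case/andP=> /andP[/eqP ij]; subst; rewrite tagged_asE eqxx tagged_asE /= => xu uc.
by apply/existsP; exists u; rewrite xu.
Qed.

Lemma pcol_root j (x : X j) : pcol (None : add_root X) (branch x) = Some j.
Proof.
have hU := add_root_forest hX.
have [c sc] := @first_step_exists _ (None : add_root X) (branch x) hU isT.
rewrite (pcolE hU sc); case: c sc => [[i c]|]; rewrite /first_step /edge /covers /=.
  case/andP=> /existsPn nu.
  rewrite ifT; last first.
    apply/forallP=> u; have := nu (branch u).
    by rewrite /= eqxx tagged_asE.
  by case/orP=> [/eqP/(congr1 (omap (@tag _ _)))|/andP[/eqP ij _]];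
    rewrite -?ij.
by [].
Qed.

Lemma pcol_cross i j (x : X i) (y : X j) :
  i != j -> pcol (branch x) (branch y) = None.
Proof.
move=> ij; apply/eqP; rewrite pcol_None /=; last exact: add_root_forest.
by rewrite (negbTE ij).
Qed.

Lemma pcol_to_root (v : add_root X) : pcol v None = None.
Proof.
apply/eqP; rewrite pcol_None; last exact: add_root_forest.
by case: v.
Qed.

End AddRoot.

Lemma pcol_lr P Q (x : P) (y : Q) : is_forest P -> is_forest Q ->
  @pcol (disj_union P Q) (inl x) (inr y) = None.
Proof. by move=> hP hQ; apply/eqP; rewrite pcol_None //; exact: disj_union_forest. Qed.

Lemma pcol_rl P Q (x : P) (y : Q) : is_forest P -> is_forest Q ->
  @pcol (disj_union P Q) (inr y) (inl x) = None.
Proof. by move=> hP hQ; apply/eqP; rewrite pcol_None //; exact: disj_union_forest. Qed.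

End PathColor.

(** * Isomorphism classes of subforests *)

Section Classes.
Variable n : nat.
Implicit Types (P Q : cposet n) (u : forest n).

(** Total, so that the class of a subforest can be named without carrying along
    a proof that it is a forest. *)
Definition cls P : forest n :=
  match @idP (is_forest P) with
  | ReflectT hP => class hP
  | ReflectF _ => fempty n
  end.

Definition cl P (A : {set P}) : forest n := cls (subforest A).

Lemma clsE P (hP : is_forest P) : cls P = class hP.
Proof. by rewrite /cls; case: {-}_ / idP => // h; apply/class_eq/iso_refl. Qed.

Lemma clsK P : is_forest P -> iso (poset_of (cls P)) P.
Proof. by move=> hP; rewrite (clsE hP); apply: classK. Qed.

Lemma cls_eq P Q : is_forest P -> iso P Q -> cls P = cls Q.
Proof.
by move=> hP PQ; rewrite (clsE hP) (clsE (iso_forest PQ hP)); apply: class_eq.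
Qed.

Lemma cls_poset u : cls (poset_of u) = u.
Proof. by apply: poset_of_inj; apply/clsK/poset_ofP. Qed.

Lemma clK P (A : {set P}) : is_forest P -> iso (poset_of (cl A)) (subforest A).
Proof. by move=> hP; apply/clsK/subforest_forest. Qed.

Lemma nvert_cls P : is_forest P -> nvert (cls P) = #|P|.
Proof. by move=> hP; apply: iso_card; apply: clsK. Qed.

Lemma nvert_cl P (A : {set P}) : is_forest P -> nvert (cl A) = #|A|.
Proof.
by move=> hP; rewrite nvert_cls ?subforest_forest // card_sig; apply: eq_card.
Qed.

Lemma cl_eqP P (A : {set P}) u : is_forest P ->
  iso (subforest A) (poset_of u) = (cl A == u).
Proof.
move=> hP; apply/idP/eqP=> [Au|<-]; last by rewrite iso_sym clK.
by apply: poset_of_inj; apply: iso_trans Au; apply: clK.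
Qed.

Lemma cls_empty : cls (empty_poset n) = fempty n.
Proof. by rewrite (clsE (empty_forest n)). Qed.

Lemma nvert0 : nvert (fempty n) = 0%N.
Proof. by rewrite /nvert (iso_card (classK _)) card_void. Qed.

Lemma cl_eq_empty P (A : {set P}) :
  is_forest P -> (cl A == fempty n) = (A == set0).
Proof.
move=> hP; rewrite -cards_eq0 -(nvert_cl A) //.
by apply/eqP/eqP=> [->|/nvert_eq0 //]; apply: nvert0.
Qed.

Lemma cl_set0 P : is_forest P -> cl (@set0 P) = fempty n.
Proof. by move=> hP; apply/eqP; rewrite cl_eq_empty. Qed.

(** An embedding restricts to an isomorphism from a subforest to its image. *)
Lemma cl_imset P Q (f : P -> Q) (A : {set P}) :
  is_forest P -> is_forest Q -> emb f -> cl (f @: A) = cl A.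
Proof.
move=> hP hQ ef; have [fi fp] := ef.
have hA := subforest_forest A hP; have hB := subforest_forest (f @: A) hQ.
have fA (x : subforest A) : f (val x) \in f @: A by rewrite imset_f // (valP x).
pose g (x : subforest A) : subforest (f @: A) := Sub (f (val x)) (fA x).
have gi : injective g by move=> x y [] /fi; apply: val_inj.
apply/esym/cls_eq => //; apply: (emb_iso hA hB (f := g)); last first.
  apply: inj_card_bij => //; rewrite !card_sig.
  by rewrite [X in (X <= _)%N](card_imset _ fi).
split=> // x y.
by rewrite -(emb_val (f @: A) hQ).2 -(emb_val A hP).2 /= fp.
Qed.

Lemma cl_setT P : is_forest P -> cl [set: P] = cls P.
Proof.
move=> hP; apply: cls_eq; first exact: subforest_forest.
apply: (@emb_iso _ (subforest [set: P]) P val) => //.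
- exact: subforest_forest.
- exact: emb_val.
apply: inj_card_bij; first exact: val_inj.
by rewrite card_sig; apply: subset_leq_card; apply/subsetP=> x _; rewrite inE.
Qed.

Lemma cls_imset P Q (f : P -> Q) :
  is_forest P -> is_forest Q -> emb f -> cls P = cl (f @: [set: P]).
Proof. by move=> hP hQ ef; rewrite cl_imset // cl_setT. Qed.

(** Allows to replace computations in the chosen representative of a class by
    computations with subsets of [P]. *)
Lemma cl_emb P (A : {set P}) : is_forest P ->
  exists2 f : poset_of (cl A) -> P, emb f & f @: [set: poset_of (cl A)] = A.
Proof.
move=> hP; case/isoP: (clK A hP) => g ig; exists (val \o g).
  by apply: emb_comp (emb_val A hP); apply: iso_emb => //; apply: poset_ofP.
have [[h gK hK] _ _] := ig; apply/setP=> x; apply/imsetP/idP=> [[y _ ->]|xA].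
  exact: (valP (g y)).
by exists (h (exist _ x xA)) => //; rewrite /= [g (h _)]hK.
Qed.

Lemma cls_emb P : is_forest P ->
  exists2 f : poset_of (cls P) -> P, emb f & bijective f.
Proof.
move=> hP; case/isoP: (clsK hP) => g ig; exists g; last by case: ig.
by apply: iso_emb => //; apply: poset_ofP.
Qed.

(** ** Disjoint unions of unrelated sets *)

Definition unrelated P (A B : {set P}) : bool :=
  [forall x in A, forall y in B, (pcol x y == None) && (pcol y x == None)].

Lemma unrelatedP P (A B : {set P}) :
  reflect (forall x y, x \in A -> y \in B -> pcol x y = None /\ pcol y x = None)
          (unrelated A B).
Proof.
apply: (iffP forall_inP) => [h x y xA yB|h x xA].
  by have /forall_inP/(_ y yB)/andP[/eqP -> /eqP ->] := h x xA.
by apply/forall_inP=> y yB; have [-> ->] := h x y xA yB.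
Qed.

Lemma unrelatedC P (A B : {set P}) : unrelated A B = unrelated B A.
Proof.
by apply/unrelatedP/unrelatedP=> h x y xA yB; have [] := h y x yB xA.
Qed.

Lemma cls_disj_union P Q : is_forest P -> is_forest Q ->
  cls (disj_union P Q) = funion (cls P) (cls Q).
Proof.
move=> hP hQ; rewrite (clsE (disj_union_forest hP hQ)) /funion; apply: class_eq.
by apply: disj_union_iso; rewrite iso_sym clsK.
Qed.

Lemma cl_setU P (A B : {set P}) :
  is_forest P -> [disjoint A & B] -> unrelated A B ->
  cl (A :|: B) = funion (cl A) (cl B).
Proof.
move=> hP dAB /unrelatedP uAB.
have [hA hB] := (subforest_forest A hP, subforest_forest B hP).
rewrite -cls_disj_union //; have hU := disj_union_forest hA hB.
pose g (x : disj_union (subforest A) (subforest B)) : P :=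
  match x with inl y => val y | inr y => val y end.
have eg : emb g.
  split=> [[x|x] [y|y] //= xy|[x|x] [y|y] /=].
  - by congr inl; apply: val_inj.
  - by have := disjointFr dAB (svalP x); rewrite xy (svalP y).
  - by have := disjointFr dAB (svalP y); rewrite -xy (svalP x).
  - by congr inr; apply: val_inj.
  - by rewrite (emb_inl hA hB).2 -(emb_val A hP).2.
  - by rewrite pcol_lr //; have [] := uAB _ _ (valP x) (valP y).
  - by rewrite pcol_rl //; have [] := uAB _ _ (valP y) (valP x).
  - by rewrite (emb_inr hA hB).2 -(emb_val B hP).2.
rewrite (cls_imset hU hP eg); congr cl; apply/setP=> x; rewrite inE.
apply/orP/imsetP=> [[xA|xB]|[[y|y] _ ->]]; last 2 first.
- by left; apply: (valP y).
- by right; apply: (valP y).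
- by exists (inl (Sub x xA)).
- by exists (inr (Sub x xB)).
Qed.

Lemma cl_bigcup P (I : finType) (r : seq I) (B : I -> {set P}) :
  is_forest P -> uniq r ->
  (forall i j, i != j -> [disjoint B i & B j] && unrelated (B i) (B j)) ->
  cl (\bigcup_(i <- r) B i) = \big[mmul/mone]_(i <- r) cl (B i).
Proof.
move=> hP + hB; elim: r => [|i r IHr] /=; first by rewrite !big_nil cl_set0.
case/andP=> ir ur; rewrite !big_cons -IHr //.
have inB x : x \in \bigcup_(j <- r) B j -> exists2 j, j != i & x \in B j.
  rewrite big_seq; elim/big_rec: _ => [|j C jr IHC]; rewrite inE // => /orP[xj|//].
    by exists j => //; apply: contraNneq ir => <-.
apply: cl_setU => //; last first.
  apply/unrelatedP=> x y xi /inB[j ji yj].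
  by have /andP[_ /unrelatedP] := hB j i ji => /(_ y x yj xi) [].
rewrite -setI_eq0; apply/eqP/setP=> x; rewrite !inE; apply/negP.
case/andP=> xi /inB[j ji xj]; have /andP[/disjointFr/(_ xj)] := hB j i ji.
by rewrite xi.
Qed.

(** ** Subforests with a root *)

Definition root_of P (A : {set P}) (r : P) : bool :=
  (r \in A) && [forall v in A, (v != r) ==> below r v].

Lemma root_ofP P (A : {set P}) r :
  reflect (r \in A /\ forall v, v \in A -> v != r -> below r v) (root_of A r).
Proof.
apply: (iffP andP) => -[rA h]; split=> //.
  by move=> v vA vr; have /forall_inP/(_ v vA)/implyP := h; apply.
by apply/forall_inP=> v vA; apply/implyP; apply: h.
Qed.

(** A tree is its root together with the branches, sorted by the color of their
    edge to the root.  Vertices with different such colors are unrelated, so each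
    color class is a disjoint union of branches. *)
Lemma cl_add_root P (A : {set P}) r : is_forest P -> root_of A r ->
  cl A = add_root_forests
           [ffun j => cl [set v in A | pcol r v == Some j]].
Proof.
move=> hP /root_ofP[rA rmin]; pose B j := [set v in A | pcol r v == Some j].
set z := [ffun j => _].
have zB j : z j = cl (B j) by rewrite ffunE.
have ex j : exists f : poset_of (z j) -> P,
    emb f /\ f @: [set: poset_of (z j)] = B j.
  by rewrite zB; have [f ef fB] := cl_emb (B j) hP; exists f.
have [f fP] := fin_all_exists ex.
have inB j x : f j x \in B j by rewrite -(fP j).2 imset_f.
have hz j := poset_ofP (z j); have hZ := add_root_forest hz.
pose g (s : add_root (fun j => poset_of (z j))) : P :=
  if s is Some t then f (tag t) (tagged t) else r.
have rf i x : pcol r (f i x) = Some i.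
  by have := inB i x; rewrite inE => /andP[_ /eqP].
have nr i x : f i x <> r.
  move=> e; have := pcol_isSome r (f i x) hP; rewrite rf e.
  by have /is_forestP[-> ] := hP.
(* A step from one branch to another would carry the color of the first. *)
have cross i j x y : i != j -> pcol (f i x) (f j y) = None.
  move=> ij; apply/eqP; rewrite pcol_None //; apply: contra ij => fxy.
  have rx : below r (f i x) by rewrite -pcol_isSome // rf.
  by have := pcol_mid hP rx fxy; rewrite !rf => -[->].
have eg : emb g.
  split=> [[[i x]|] [[j y]|] //=|[[i x]|] [[j y]|]].
  - move=> fxy; have ij : i = j.
      by have := rf i x; rewrite fxy rf => -[].
    by subst j; move/(fP i).1.1: fxy => ->.
  - by move/nr.
  - by move/esym/nr.
  - have [eij|ij] := eqVneq i j.
      by subst j; rewrite (emb_branch hz i).2 (fP i).1.2.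
    by rewrite [LHS]cross // (@pcol_cross _ _ hz i j x y).
  - rewrite pcol_to_root // [LHS](_ : _ = pcol (f i x) r) //.
    apply/eqP; rewrite pcol_None //; apply/negP => xr.
    have /is_forestP[h1 h2 _ _] := hP; have := h1 r; rewrite (h2 (f i x)) //.
    by rewrite -pcol_isSome // rf.
  - by rewrite (@pcol_root _ _ hz j y) [LHS]rf.
  - rewrite pcol_to_root //; apply/eqP; rewrite pcol_None //=.
    by have /is_forestP[->] := hP.
rewrite /add_root_forests -clsE (cls_imset hZ hP eg); congr cl.
apply/setP=> v; apply/idP/imsetP=> [vA|[[[j x]|] _ ->] //=]; last first.
  by have := inB j x; rewrite inE => /andP[].
have [->|vr] := eqVneq v r; first by exists None.
have := rmin v vA vr; rewrite -pcol_isSome //; case rv: (pcol r v) => [j|] // _.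
have : v \in f j @: [set: poset_of (z j)] by rewrite (fP j).2 inE vA rv eqxx.
by case/imsetP=> x _ ->; exists (Some (Tagged (fun j => poset_of (z j)) x)).
Qed.

End Classes.

(** * Weights *)

Section Weights.
Variables (n : nat) (k : comNzRingType).
Implicit Types (P Q : cposet n) (q : 'I_n -> k).

Definition pweight q (o : option 'I_n) : k := if o is Some j then q j else 1.

Definition cross q P (A B : {set P}) : k :=
  \prod_(w in A) \prod_(v in B) pweight q (pcol w v).

(** Each vertex below [v] is the lower vertex of exactly one edge on the path from
    [v] to its root, so edges can be counted by their lower vertices. *)
Lemma npathE P (A : {set P}) j v : is_forest P ->
  npath A j v = #|[set w | (pcol w v == Some j) && (w \notin A)]|.
Proof.
move=> hP; set W := [set w | _].
pose s w := odflt w [pick c | first_step w v c].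
have sE w c : first_step w v c -> s w = c.
  move=> sc; rewrite /s; case: pickP => [d sd|/(_ c)]; last by rewrite sc.
  exact: first_step_uniq sd sc.
have <- : #|[set (w, s w) | w in W]| = #|W|.
  by rewrite card_imset // => x y [].
apply: eq_card => -[w c]; rewrite !inE /=; apply/and4P/imsetP=> [[wc cv wj wA]|].
  have sc : first_step w v c by rewrite /first_step wc.
  by exists w; rewrite ?(sE _ _ sc) // inE (pcolE hP sc) wj.
case=> x; rewrite inE => /andP[/eqP xj xA] [-> ->].
have xv : below x v by rewrite -(pcol_isSome x v hP) xj.
have [d sd] := first_step_exists hP xv.
rewrite (sE _ _ sd) -(pcolE hP sd) xj eqxx xA; case/andP: sd => -> /orP[] -> //.
by rewrite orbT.
Qed.

Lemma prod_npath q P (A : {set P}) : is_forest P ->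
  \prod_(j < n) q j ^+ (\sum_(v in A) npath A j v) = cross q (~: A) A.
Proof.
move=> hP; rewrite /cross exchange_big /=.
under eq_bigr => j _ do rewrite expr_sum.
rewrite exchange_big /=; apply: eq_bigr => v _.
transitivity (\prod_(j < n) \prod_(w in ~: A)
    (if pcol w v == Some j then q j else 1)).
  apply: eq_bigr => j _; rewrite npathE // -big_mkcondr /= -prodr_const.
  by apply: eq_bigl => w; rewrite !inE andbC.
rewrite exchange_big /=; apply: eq_bigr => w _.
case: (pcol w v) => [i|] /=; last by rewrite big1.
rewrite (bigD1 i) //= eqxx big1 ?mulr1 // => j ji.
by rewrite ifF //; apply/eqP=> -[ij]; rewrite ij eqxx in ji.
Qed.

Lemma qweightE q1 q2 P (A : {set P}) : is_forest P ->
  qweight q1 q2 A = cross q1 (~: A) A * cross q2 A (~: A).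
Proof. by move=> hP; rewrite /qweight !prod_npath // setCK. Qed.

Lemma cross_imset q P Q (f : P -> Q) (A B : {set P}) :
  emb f -> cross q (f @: A) (f @: B) = cross q A B.
Proof.
case=> fi fp; rewrite /cross big_imset /=; last by move=> x y _ _; apply: fi.
apply: eq_bigr => w _; rewrite big_imset /=; last by move=> x y _ _; apply: fi.
by apply: eq_bigr => v _; rewrite fp.
Qed.

Lemma prod_setU (T : finType) (A B : {set T}) (F : T -> k) :
  [disjoint A & B] ->
  \prod_(x in A :|: B) F x = \prod_(x in A) F x * \prod_(x in B) F x.
Proof. by move=> dAB; rewrite -bigU //; apply: eq_bigl => x; rewrite !inE. Qed.

Lemma cross_setUl q P (A B C : {set P}) :
  [disjoint A & B] -> cross q (A :|: B) C = cross q A C * cross q B C.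
Proof. exact: prod_setU. Qed.

Lemma crossC q P (A B : {set P}) :
  cross q A B = \prod_(v in B) \prod_(w in A) pweight q (pcol w v).
Proof. by rewrite /cross exchange_big. Qed.

Lemma cross_setUr q P (A B C : {set P}) :
  [disjoint A & B] -> cross q C (A :|: B) = cross q C A * cross q C B.
Proof. by move=> dAB; rewrite !crossC prod_setU. Qed.

Lemma cross_unrelated q P (A B : {set P}) : unrelated A B -> cross q A B = 1.
Proof.
move/unrelatedP=> u; rewrite /cross big1 // => x xA.
by rewrite big1 // => y yB; have [-> _] := u x y xA yB.
Qed.

Lemma cross_set0 q P (A : {set P}) : cross q set0 A = 1.
Proof. by rewrite /cross big_set0. Qed.

Lemma cross_set0r q P (A : {set P}) : cross q A set0 = 1.
Proof. by rewrite crossC big_set0. Qed.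

(** Weight of a pair of disjoint sets of vertices; for a set and its complement
    this is [qweight], but only this form passes to subforests. *)
Definition biweight (q1 q2 : 'I_n -> k) P (A B : {set P}) : k :=
  cross q1 B A * cross q2 A B.

Lemma biweightE q1 q2 P (A : {set P}) :
  is_forest P -> qweight q1 q2 A = biweight q1 q2 A (~: A).
Proof. exact: qweightE. Qed.

Lemma biweight_imset q1 q2 P Q (f : P -> Q) (A B : {set P}) :
  emb f -> biweight q1 q2 (f @: A) (f @: B) = biweight q1 q2 A B.
Proof. by move=> ef; rewrite /biweight !cross_imset. Qed.

Lemma biweight_unrelated q1 q2 P (A B : {set P}) :
  unrelated A B -> biweight q1 q2 A B = 1.
Proof.
by move=> u; rewrite /biweight !cross_unrelated ?mulr1 // unrelatedC.
Qed.

Lemma biweight_set0 q1 q2 P (A : {set P}) : biweight q1 q2 set0 A = 1.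
Proof. by rewrite /biweight cross_set0 cross_set0r mulr1. Qed.

Lemma biweight_set0r q1 q2 P (A : {set P}) : biweight q1 q2 A set0 = 1.
Proof. by rewrite /biweight cross_set0 cross_set0r mulr1. Qed.

(** Cutting [A] and [B] off one after the other, in either order, weighs every
    pair of vertices from different parts exactly once.  This is what makes the
    coproduct coassociative. *)
Lemma biweight_assoc q1 q2 P (A B C : {set P}) :
  [disjoint A & B] -> [disjoint B & C] ->
  biweight q1 q2 (A :|: B) C * biweight q1 q2 A B =
  biweight q1 q2 A (B :|: C) * biweight q1 q2 B C.
Proof.
move=> dAB dBC; rewrite /biweight cross_setUr // !cross_setUl // cross_setUr //.
by rewrite !mulrA [LHS](ACl (5*1*6*3*2*4)).
Qed.

End Weights.

(** * Linear maps on free modules *)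

(** Locked, so that unifying two distinct basis vectors fails at once instead of
    unfolding finite maps. *)
HB.lock Definition bvec (k : fieldType) (K : choiceType) (u : K) : {malg k[K]} :=
  << u >>.

Notation "''e_' u" := (bvec _ u) (at level 8, u at level 2, format "''e_' u").

Section FreeModuleTheory.
Variable k : fieldType.
Implicit Types K L : choiceType.

Lemma bvecE K (u : K) : << u >> = 'e_u :> {malg k[K]}.
Proof. by rewrite bvec.unlock. Qed.

Lemma linextU K (V : lmodType k) (f : K -> V) u : linext f 'e_u = f u.
Proof. by rewrite -bvecE linext_basis. Qed.

Lemma linextEw K (V : lmodType k) (f : K -> V) (d : {fset K}) x :
  (msupp x `<=` d)%fset -> linext f x = \sum_(u <- d) x@_u *: f u.
Proof.
move=> le; rewrite /linext (big_fset_incl _ le) //= => u _ /mcoeff_outdom ->.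
by rewrite scale0r.
Qed.

Lemma linext_is_linear K (V : lmodType k) (f : K -> V) : linear (linext f).
Proof.
move=> a x y.
pose d := (msupp x `|` msupp y `|` msupp (a *: x + y))%fset.
have [dx [dy da]] : (msupp x `<=` d)%fset /\ (msupp y `<=` d)%fset /\
    (msupp (a *: x + y) `<=` d)%fset.
  by split; [|split]; apply/fsubsetP=> u; rewrite !in_fsetU => -> //; rewrite orbT.
rewrite !(@linextEw _ _ f d) //.
rewrite scaler_sumr -big_split /=; apply: eq_bigr => u _.
by rewrite mcoeffD mcoeffZ scalerDl scalerA.
Qed.

HB.instance Definition _ K (V : lmodType k) (f : K -> V) :=
  GRing.isLinear.Build k {malg k[K]} V *:%R (linext f) (linext_is_linear f).

Section LinearPred.
Variables (U V : lmodType k) (f : U -> V) (fL : linear f).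

Lemma lin0 : f 0 = 0.
Proof. by have := fL (-1) 0 0; rewrite scaler0 add0r scaleN1r addNr. Qed.

Lemma linD x y : f (x + y) = f x + f y.
Proof. by have := fL 1 x y; rewrite !scale1r. Qed.

Lemma linZ a x : f (a *: x) = a *: f x.
Proof. by have := fL a x 0; rewrite !addr0 lin0 addr0. Qed.

Lemma linB x y : f (x - y) = f x - f y.
Proof. by rewrite -!scaleN1r linD linZ. Qed.

Lemma lin_sum I (r : seq I) (p : pred I) F :
  f (\sum_(i <- r | p i) F i) = \sum_(i <- r | p i) f (F i).
Proof. exact: (big_morph f linD lin0). Qed.

End LinearPred.

Lemma lin_comp (U V W : lmodType k) (f : V -> W) (g : U -> V) :
  linear f -> linear g -> linear (fun x => f (g x)).
Proof. by move=> fL gL a x y; rewrite gL fL. Qed.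

Lemma lin_add (U V : lmodType k) (f g : U -> V) :
  linear f -> linear g -> linear (fun x => f x + g x).
Proof. by move=> fL gL a x y; rewrite fL gL scalerDr addrACA. Qed.

Lemma lin_sub (U V : lmodType k) (f g : U -> V) :
  linear f -> linear g -> linear (fun x => f x - g x).
Proof.
by move=> fL gL a x y; rewrite fL gL scalerBr opprD addrACA.
Qed.

Lemma linext_linearr K (U V : lmodType k) (F : K -> U -> V) x :
  (forall u, linear (F u)) -> linear (fun y => linext (fun u => F u y) x).
Proof.
move=> FL a y z; rewrite /linext scaler_sumr -big_split; apply: eq_bigr => u _ /=.
by rewrite FL scalerDr !scalerA mulrC.
Qed.

Lemma commutator_jacobi (U : lmodType k) (mul : U -> U -> U) one
    (c := fun x y => mul x y - mul y x) :
  is_algebra mul one ->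
  forall x y z, c x (c y z) + c y (c z x) + c z (c x y) = 0.
Proof.
case=> -[bl br] mA _ _ x y z; rewrite /c.
have mBr u v w : mul u (v - w) = mul u v - mul u w by exact: (linB (br u)).
have mBl u v w : mul (v - w) u = mul v u - mul w u by exact: (linB (bl u)).
rewrite !mBr !mBl !mA !opprB !addrA !subrK.
(* [subrK] has cancelled two of the six pairs; the permutation makes the others
   adjacent. *)
rewrite [LHS](ACl (1*8*2*5*3*6*4*7)) /=.
by rewrite subrr add0r addNr add0r subrr add0r addNr.
Qed.

Lemma malg_basisE K (x : {malg k[K]}) : x = \sum_(u <- msupp x) x@_u *: 'e_u.
Proof.
by rewrite [LHS]monalgE; apply: eq_bigr => u _; rewrite malg_scaleU bvecE.
Qed.

Lemma linear_basisE K (V : lmodType k) (f : {malg k[K]} -> V) x :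
  linear f -> f x = linext (fun u => f 'e_u) x.
Proof.
move=> fL; rewrite {1}[x]malg_basisE lin_sum //.
by apply: eq_bigr => u _; rewrite linZ.
Qed.

Lemma linear_basis_eq K (V : lmodType k) (f g : {malg k[K]} -> V) :
  linear f -> linear g -> (forall u, f 'e_u = g 'e_u) -> f =1 g.
Proof.
move=> fL gL fg x; rewrite (linear_basisE x fL) (linear_basisE x gL).
by apply: eq_bigr => u _; rewrite fg.
Qed.

Lemma mcoeff_basis K (u v : K) : ('e_u : {malg k[K]})@_v = (u == v)%:R.
Proof. by rewrite -bvecE mcoeffU. Qed.

Lemma mcoeff_sum K I (r : seq I) (p : pred I) (F : I -> {malg k[K]}) v :
  (\sum_(i <- r | p i) F i)@_v = \sum_(i <- r | p i) (F i)@_v.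
Proof. exact: raddf_sum. Qed.

Lemma mcoeff_linext K L (f : K -> {malg k[L]}) x v :
  (linext f x)@_v = \sum_(u <- msupp x) x@_u * (f u)@_v.
Proof. by rewrite mcoeff_sum; apply: eq_bigr => u _; rewrite mcoeffZ. Qed.

Lemma linext_sum_basis K (V : lmodType k) (f : K -> V) I (r : seq I) (p : pred I)
    (c : I -> k) (z : I -> K) :
  linext f (\sum_(i <- r | p i) c i *: 'e_(z i))
    = \sum_(i <- r | p i) c i *: f (z i).
Proof.
by rewrite raddf_sum; apply: eq_bigr => i _; rewrite /= linearZ /= linextU.
Qed.

Lemma malgU_mul (K : monomType) (u v : K) :
  ('e_u * 'e_v : {malg k[K]}) = 'e_(mmul u v).
Proof. by rewrite -!bvecE malgM_def fgmulUU mulr1. Qed.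

Lemma tensor_basis K L (a : K) (b : L) :
  tensor 'e_a 'e_b = 'e_(a, b) :> {malg k[(K * L)%type]}.
Proof.
apply/malgP=> -[a' b']; rewrite mcoeff_tensor !mcoeff_basis xpair_eqE.
by rewrite -natrM mulnb.
Qed.

Lemma tensorZ K L a b (x : {malg k[K]}) (y : {malg k[L]}) :
  tensor (a *: x) (b *: y) = (a * b) *: tensor x y.
Proof.
by apply/malgP=> -[u v]; rewrite mcoeffZ !mcoeff_tensor !mcoeffZ mulrACA.
Qed.

End FreeModuleTheory.

(** * The coproduct as a sum over subforests *)

Section Coproduct.
Variables (k : fieldType) (n : nat) (q1 q2 : 'I_n -> k).
Implicit Types (P Q : cposet n) (u v : forest n).

Definition cop P : Ctrees2 k n :=
  \sum_(A : {set P}) biweight q1 q2 A (~: A) *: 'e_(cl A, cl (~: A)).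

Lemma imset_bij P Q (f : P -> Q) : bijective f ->
  bijective (fun A : {set P} => f @: A).
Proof.
case=> g fK gK; exists (fun B : {set Q} => g @: B) => A;
  rewrite -imset_comp -[RHS]imset_id; apply: eq_imset => x; rewrite /= ?fK ?gK //.
Qed.

Lemma imsetC_bij P Q (f : P -> Q) (A : {set P}) : bijective f ->
  ~: (f @: A) = f @: (~: A).
Proof.
move=> bf; have fi := bij_inj bf; case: bf => g fK gK.
by apply/setP=> x; rewrite -[x]gK !(inE, mem_imset).
Qed.

Lemma cop_emb P Q (f : P -> Q) :
  is_forest P -> is_forest Q -> emb f -> bijective f -> cop P = cop Q.
Proof.
move=> hP hQ ef bf; have bij := imset_bij bf.
rewrite /cop [RHS](reindex _ (onW_bij _ bij)) /=; apply: eq_bigr => A _.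
by rewrite (imsetC_bij A bf) (biweight_imset _ _ _ _ ef) 2!(cl_imset _ hP hQ ef).
Qed.

Lemma cop_cls P : is_forest P -> cop (poset_of (cls P)) = cop P.
Proof.
by move=> hP; have [f ef bf] := cls_emb hP; apply: cop_emb ef bf => //;
  apply: poset_ofP.
Qed.

Definition sum_set P Q (p : {set P} * {set Q}) : {set disj_union P Q} :=
  (inl @: p.1) :|: (inr @: p.2).

Lemma sum_set_bij P Q : bijective (@sum_set P Q).
Proof.
exists (fun A : {set disj_union P Q} => (inl @^-1: A, inr @^-1: A)).
  case=> A B; rewrite /sum_set /=; congr (_, _); apply/setP=> x; rewrite !inE /=.
    rewrite mem_imset; last by move=> a b [].
    by apply/orb_idr => /imsetP[].
  rewrite orbC mem_imset; last by move=> a b [].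
  by apply/orb_idr => /imsetP[].
move=> A; apply/setP=> -[x|x]; rewrite !inE /=.
  rewrite mem_imset ?inE; last by move=> a b [].
  by apply/orb_idr => /imsetP[].
rewrite orbC mem_imset ?inE; last by move=> a b [].
by apply/orb_idr => /imsetP[].
Qed.

Lemma sum_setC P Q (A : {set P}) (B : {set Q}) :
  ~: sum_set (A, B) = sum_set (~: A, ~: B).
Proof.
have il (C : {set P}) x : (@inl P Q x \in inl @: C) = (x \in C).
  by apply: mem_imset => a b [].
have ir (C : {set Q}) x : (@inr P Q x \in inr @: C) = (x \in C).
  by apply: mem_imset => a b [].
have il0 (C : {set P}) x : (@inr P Q x \in inl @: C) = false by apply/imsetP => -[].
have ir0 (C : {set Q}) x : (@inl P Q x \in inr @: C) = false by apply/imsetP => -[].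
by apply/setP=> -[x|x]; rewrite !inE /= ?il ?ir ?il0 ?ir0 ?inE ?orbF.
Qed.

Section DisjUnion.
Variables (P Q : cposet n) (hP : is_forest P) (hQ : is_forest Q).

Let unrel (A : {set P}) (B : {set Q}) :
  @unrelated _ (disj_union P Q) (inl @: A) (inr @: B).
Proof.
by apply/unrelatedP=> _ _ /imsetP[x _ ->] /imsetP[y _ ->]; rewrite pcol_lr ?pcol_rl.
Qed.

Let disj (A : {set P}) (B : {set Q}) :
  [disjoint (inl @: A : {set disj_union P Q}) & (inr @: B : {set disj_union P Q})].
Proof.
by rewrite disjoint_subset; apply/subsetP=> _ /imsetP[x _ ->]; apply/imsetP=> -[].
Qed.

Lemma cl_sum_set (A : {set P}) (B : {set Q}) :
  cl (sum_set (A, B)) = funion (cl A) (cl B).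
Proof.
have hU := disj_union_forest hP hQ.
rewrite /sum_set cl_setU // (cl_imset A hP hU (emb_inl hP hQ)).
by rewrite (cl_imset B hQ hU (emb_inr hP hQ)).
Qed.

Lemma biweight_sum_set (A A' : {set P}) (B B' : {set Q}) :
  biweight q1 q2 (sum_set (A, B)) (sum_set (A', B')) =
  biweight q1 q2 A A' * biweight q1 q2 B B'.
Proof.
have cr q (C C' : {set P}) (D D' : {set Q}) :
    cross q (sum_set (C, D)) (sum_set (C', D')) = cross q C C' * cross q D D'.
  rewrite /sum_set /= cross_setUl // !cross_setUr //.
  rewrite [X in _ * X * _]cross_unrelated // [X in _ * (X * _)]cross_unrelated.
    rewrite mulr1 mul1r (cross_imset _ _ _ (emb_inl hP hQ)).
    by rewrite (cross_imset _ _ _ (emb_inr hP hQ)).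
  by rewrite unrelatedC.
by rewrite /biweight !cr mulrACA.
Qed.

Lemma cop_disj_union : cop (disj_union P Q) = cop P * cop Q.
Proof.
rewrite /cop (reindex _ (onW_bij _ (@sum_set_bij P Q))) /=.
rewrite mulr_suml; under [RHS]eq_bigr => A _ do rewrite mulr_sumr.
rewrite pair_bigA /=; apply: eq_bigr => -[A B] _ /=.
rewrite sum_setC biweight_sum_set !cl_sum_set.
by rewrite -scalerAl -scalerAr scalerA malgU_mul.
Qed.

End DisjUnion.

Definition Delta : Ctrees k n -> Ctrees2 k n :=
  linext (fun u => cop (poset_of u)).

HB.instance Definition _ := GRing.Linear.on Delta.

Lemma Delta_basis u : Delta 'e_u = cop (poset_of u).
Proof. exact: linextU. Qed.

Lemma Delta_cls P : is_forest P -> Delta 'e_(cls P) = cop P.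
Proof. by move=> hP; rewrite Delta_basis cop_cls. Qed.

Lemma cop_funion u v :
  cop (poset_of (funion u v)) = cop (poset_of u) * cop (poset_of v).
Proof.
have [hu hv] := (poset_ofP u, poset_ofP v).
by rewrite -{1}[u]cls_poset -{1}[v]cls_poset -cls_disj_union // cop_cls
  ?cop_disj_union //; apply: disj_union_forest.
Qed.

Lemma cop_empty : cop (poset_of (fempty n)) = 1.
Proof.
have h0 := empty_forest n.
rewrite -cls_empty cop_cls // /cop (bigD1 set0) //= big1 ?addr0; last first.
  by move=> A /set0Pn[[]].
have -> : ~: set0 = set0 :> {set empty_poset n} by apply/setP=> -[].
by rewrite biweight_set0 scale1r cl_set0 // -bvecE.
Qed.

Lemma Delta_is_monoid_morphism : monoid_morphism Delta.
Proof.
split.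
  have -> : 1 = 'e_(fempty n) :> Ctrees k n by rewrite -bvecE.
  by rewrite Delta_basis cop_empty.
have linl (z : Ctrees k n) : linear (fun x => Delta (x * z)).
  by move=> a x y; rewrite mulrDl -scalerAl linearP.
have linr (z : Ctrees2 k n) : linear (fun x => Delta x * z).
  by move=> a x y; rewrite linearP mulrDl -scalerAl.
move=> x y; apply: (@linear_basis_eq _ (forest n) _ _ _ (linl y) (linr (Delta y))).
move=> {x}u.
rewrite mulrC [RHS]mulrC.
apply: (@linear_basis_eq _ (forest n) _ _ _ (linl 'e_u) (linr (Delta 'e_u))).
move=> {y}v.
by rewrite malgU_mul !Delta_basis cop_funion.
Qed.

HB.instance Definition _ := GRing.isMonoidMorphism.Build _ _ Delta
  Delta_is_monoid_morphism.

End Coproduct.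

(** * The recursion for the coproduct *)

Section Fibers.
Variables (k : fieldType) (I : finType) (X : I -> finType).

Definition fiber j (A : {set {j : I & X j}}) : {set X j} :=
  [set x | Tagged X x \in A].

Lemma fiberC j A : fiber j (~: A) = ~: fiber j A.
Proof. by apply/setP=> x; rewrite !inE. Qed.

(** Distributivity, as a choice of a subset of each fiber is the same as one subset
    of the disjoint sum. *)
Lemma prod_sum_fiber (F : forall j, {set X j} -> k) :
  \prod_j \sum_(B : {set X j}) F j B = \sum_A \prod_j F j (fiber j A).
Proof.
pose Q j (C : {set {j : I & X j}}) := [forall s in C, tag s == j].
have sumE j : \sum_(B : {set X j}) F j B = \sum_(C | Q j C) F j (fiber j C).
  rewrite [RHS](reindex_onto (fun B : {set X j} => [set Tagged X x | x in B]) (@fiber j)).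
    have fK (B : {set X j}) : fiber j [set Tagged X x | x in B] = B.
      apply/setP=> x; rewrite inE mem_imset // => a b /eqP.
      by rewrite eq_Tagged => /eqP.
    rewrite (eq_bigl xpredT) => [|B].
      by apply: eq_bigr => B _; rewrite fK.
    by rewrite fK eqxx andbT; apply/forall_inP=> _ /imsetP[x _ ->].
  move=> C /forall_inP QC; apply/setP=> s; apply/imsetP/idP=> [[x]|sC].
    by rewrite inE => xC ->.
  by have /eqP := QC s sC; case: s sC => i x sC /= ij; subst i; exists x; rewrite ?inE.
under eq_bigr => j _ do rewrite sumE.
rewrite bigA_distr_big_dep.
pose cut j (A : {set {j : I & X j}}) := [set s in A | tag s == j].
rewrite (reindex_onto (fun A => [ffun j => cut j A])
  (fun f : {ffun I -> {set {j : I & X j}}} => \bigcup_j f j)).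
  apply: eq_big => [A|A _].
    apply/andP; split.
      apply/familyP=> j; rewrite ffunE; apply/forall_inP=> s.
      by rewrite inE => /andP[].
    apply/eqP/setP=> s; apply/bigcupP/idP=> [[j _]|sA].
      by rewrite ffunE inE => /andP[].
    by exists (tag s); rewrite ?ffunE ?inE ?sA ?eqxx.
  apply: eq_bigr => j _; congr F; apply/setP=> x.
  by rewrite ffunE !inE /= eqxx andbT.
move=> f /familyP Qf; apply/ffunP=> j; rewrite ffunE; apply/setP=> s.
rewrite inE; apply/andP/idP=> [[/bigcupP[i _ si] /eqP sj]|sj].
  by have /forall_inP/(_ s si)/eqP si' := Qf i; rewrite -sj si'.
split; first by apply/bigcupP; exists j.
by have /forall_inP := Qf j; apply.
Qed.

Lemma sum_option_set (T : finType) (V : nmodType) (G : {set option T} -> V) :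
  \sum_B G B =
  \sum_(A : {set T}) G (Some @: A) + \sum_(A : {set T}) G (None |: Some @: A).
Proof.
have SomeE (A : {set T}) x : (Some x \in Some @: A) = (x \in A).
  by apply: mem_imset => a b [].
have NoneE (A : {set T}) : (None \in Some @: A) = false by apply/imsetP=> -[].
pose some_part (B : {set option T}) := [set x | Some x \in B].
have someK (A : {set T}) : some_part (Some @: A) = A by apply/setP=> x; rewrite inE SomeE.
have someK' (A : {set T}) : some_part (None |: Some @: A) = A.
  by apply/setP=> x; rewrite !inE SomeE.
rewrite (bigID (fun B : {set option T} => None \notin B)) /=; congr (_ + _).
  rewrite (reindex_onto (fun A : {set T} => Some @: A) some_part) => [|B nB].
    by apply: eq_bigl => A; rewrite NoneE someK eqxx.
  by apply/setP=> -[x|]; rewrite ?SomeE ?inE // NoneE (negbTE nB).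
rewrite (reindex_onto (fun A : {set T} => None |: Some @: A) some_part) => [|B].
  by apply: eq_bigl => A; rewrite setU11 someK' eqxx.
by rewrite negbK => nB; apply/setP=> -[x|]; rewrite !inE ?SomeE ?inE //= nB.
Qed.

End Fibers.

Section NTensor.
Variables (k : fieldType) (n : nat).

Lemma ntensor_sum (K : choiceType) (X : 'I_n -> finType)
    (c : forall j, {set X j} -> k) (y : forall j, {set X j} -> K) :
  ntensor (fun j => \sum_B c j B *: 'e_(y j B)) =
  \sum_A (\prod_j c j (fiber j A)) *: 'e_([ffun j => y j (fiber j A)]).
Proof.
apply/malgP=> z; rewrite mcoeff_ntensor mcoeff_sum.
under eq_bigr => j _ do rewrite mcoeff_sum.
under eq_bigr => j _ do under eq_bigr => B _ do rewrite mcoeffZ mcoeff_basis.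
rewrite (prod_sum_fiber (fun j B => c j B * (y j B == z j)%:R)).
apply: eq_bigr => A _; rewrite mcoeffZ mcoeff_basis big_split /=; congr (_ * _).
case: eqP => [<-|/eqP ne]; first by rewrite big1 // => j _; rewrite ffunE eqxx.
have [j jn] : exists j, y j (fiber j A) != z j.
  apply/existsP; rewrite -negb_forall; apply: contra ne => /forallP h.
  by apply/eqP/ffunP=> j; rewrite ffunE; apply/eqP.
by rewrite (bigD1 j) //= (negbTE jn) mul0r.
Qed.

Lemma prod_basis (t : 'I_n -> forest n) :
  \prod_(j < n) 'e_(t j) = 'e_(\big[mmul/mone]_(j < n) t j) :> Ctrees k n.
Proof.
apply/esym; elim/big_rec2: _ => [|j x y _ <-]; first by rewrite -bvecE.
by rewrite malgU_mul.
Qed.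

Lemma map_tensor_sum (I : Type) (r : seq I) (K L K' L' : choiceType)
   (f : {malg k[K]} -> {malg k[K']}) (g : {malg k[L]} -> {malg k[L']}) 
   (c : I -> k) (a : I -> K) (b : I -> L) :
  map_tensor f g (\sum_(i <- r) c i *: 'e_(a i, b i)) =
  \sum_(i <- r) c i *: tensor (f 'e_(a i)) (g 'e_(b i)).
Proof.
by rewrite /map_tensor linext_sum_basis; apply: eq_bigr => i _; rewrite !bvecE.
Qed.

End NTensor.

Section AddRootCop.
Variables (k : fieldType) (n : nat) (q1 q2 : 'I_n -> k).
Variables (X : 'I_n -> cposet n) (hX : forall j, is_forest (X j)).
Local Notation S := {j : 'I_n & X j}.
Implicit Types A B : {set S}.

Let hU : is_forest (add_root X) := add_root_forest hX.

(** The vertex sets of the tree that avoid and contain the root, respectively;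
    both are determined by a set of vertices of the branches. *)
Definition above A : {set add_root X} := Some @: A.
Definition rooted_above A : {set add_root X} := None |: above A.

Lemma above_bigcup A : above A = \bigcup_j [set branch x | x in fiber j A].
Proof.
apply/setP=> s; apply/imsetP/bigcupP=> [[[j x] xA ->]|[j _ /imsetP[x]]].
  by exists j => //; apply: imset_f; rewrite inE.
by rewrite inE => xA ->; exists (Tagged X x).
Qed.

Lemma cl_above A : cl (above A) = \big[mmul/mone]_(j < n) cl (fiber j A).
Proof.
rewrite above_bigcup cl_bigcup ?index_enum_uniq //; last first.
  move=> i j ij; apply/andP; split.
    rewrite disjoint_subset; apply/subsetP=> _ /imsetP[x _ ->].
    by apply/imsetP=> -[y _ [eij _]]; rewrite eij eqxx in ij.
  apply/unrelatedP=> _ _ /imsetP[x _ ->] /imsetP[y _ ->].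
  by rewrite !pcol_cross // eq_sym.
by apply: eq_bigr => j _; apply: cl_imset => //; apply: emb_branch.
Qed.

Lemma cl_rooted_above A :
  cl (rooted_above A) = add_root_forests [ffun j => cl (fiber j A)].
Proof.
have hr : root_of (rooted_above A) None.
  apply/root_ofP; split=> [|[s|]]; rewrite ?setU11 //.
rewrite (cl_add_root hU hr); congr add_root_forests; apply/ffunP=> j.
rewrite !ffunE -(cl_imset _ (hX j) hU (emb_branch hX j)); congr cl.
apply/setP=> -[[i x]|]; rewrite inE; last first.
  by rewrite pcol_to_root // andbF; apply/esym/imsetP=> -[].
rewrite -/(branch x) pcol_root // in_setU1 /= /above.
rewrite [branch x \in _]mem_imset; last by move=> a b [].
apply/andP/imsetP=> [[xA /eqP[ij]]|[y yA [ij]]].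
  by subst j; exists x; rewrite ?inE.
subst j => /eqP; rewrite eq_Tagged => /eqP /= ->.
by move: yA; rewrite inE.
Qed.

Lemma aboveC A : ~: above A = rooted_above (~: A).
Proof.
have inj : injective (@Some S) by move=> a b [].
apply/setP=> -[s|]; rewrite !inE ?(mem_imset _ _ inj) ?inE //=.
by apply/imsetP=> -[].
Qed.

Lemma rooted_aboveC A : ~: rooted_above A = above (~: A).
Proof. by rewrite -[A in LHS]setCK -aboveC setCK. Qed.

Lemma cross_above (q : 'I_n -> k) A B :
  cross q (above A) (above B) = \prod_j cross q (fiber j A) (fiber j B).
Proof.
have inj : injective (@Some S) by move=> a b [].
have fibE (F : S -> k) (C : {set S}) : \prod_(s in C) F s =
    \prod_j \prod_(x in fiber j C) F (Tagged X x).
  by rewrite sig_big_dep /=; apply: eq_big => -[j x] //; rewrite inE.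
rewrite /cross /above big_imset /=; last by move=> x y _ _; apply: inj.
rewrite fibE; apply: eq_bigr => j _; apply: eq_bigr => x _.
rewrite big_imset /=; last by move=> ? ? _ _; apply: inj.
rewrite fibE (bigD1 j) //= [X in _ * X]big1 ?mulr1.
  apply: eq_bigr => y _.
  by rewrite -/(branch x) -/(branch y) (emb_branch hX j).2.
move=> i ij; rewrite big1 // => y _.
by rewrite -/(branch x) -/(branch y) pcol_cross // eq_sym.
Qed.

Lemma cross_root (q : 'I_n -> k) A :
  cross q [set None : add_root X] (above A) = \prod_j q j ^+ #|fiber j A|.
Proof.
rewrite /cross big_set1 /above big_imset /=; last by move=> ? ? _ _ [].
transitivity (\prod_j \prod_(x in fiber j A) q j).
  rewrite sig_big_dep /=; apply: eq_big => -[j x] /=; rewrite ?inE // => _.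
  by rewrite -/(branch x) pcol_root.
by apply: eq_bigr => j _; rewrite prodr_const.
Qed.

Lemma cross_to_root (q : 'I_n -> k) (B : {set add_root X}) : cross q B [set None] = 1.
Proof.
by rewrite /cross big1 // => s _; rewrite big_set1 pcol_to_root.
Qed.

Let disj A : [disjoint [set None : add_root X] & above A].
Proof.
rewrite disjoint_subset; apply/subsetP=> s; rewrite !inE => /eqP ->.
by apply/imsetP=> -[].
Qed.

Lemma biweight_above A B :
  biweight q1 q2 (above A) (rooted_above B) =
  (\prod_j biweight q1 q2 (fiber j A) (fiber j B)) * \prod_j q1 j ^+ #|fiber j A|.
Proof.
rewrite /biweight /rooted_above cross_setUl // cross_setUr // cross_to_root mul1r.
by rewrite cross_root !cross_above big_split /= -mulrA mulrC.
Qed.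

Lemma biweight_rooted_above A B :
  biweight q1 q2 (rooted_above A) (above B) =
  (\prod_j biweight q1 q2 (fiber j A) (fiber j B)) * \prod_j q2 j ^+ #|fiber j B|.
Proof.
rewrite /biweight /rooted_above cross_setUl // cross_setUr // cross_to_root mul1r.
by rewrite cross_root !cross_above big_split /= mulrCA mulrC.
Qed.

End AddRootCop.

Section CoproductRecursion.
Variables (k : fieldType) (n : nat) (q1 q2 : 'I_n -> k).

Lemma map_ntensor_basis (f : Ctrees k n -> Ctrees2 k n)
    (z : {ffun 'I_n -> forest n}) :
  map_ntensor f 'e_z = ntensor (fun j => f 'e_(z j)).
Proof.
by rewrite /map_ntensor linextU; apply/malgP=> v; rewrite !mcoeff_ntensor;
  apply: eq_bigr => j _; rewrite bvecE.
Qed.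

Lemma lambda_basis (z : {ffun 'I_n -> forest n}) :
  lambda 'e_z = 'e_(add_root_forests z) :> Ctrees k n.
Proof. by rewrite /lambda linextU bvecE. Qed.

Lemma sigma_basis (q : 'I_n -> k) (z : {ffun 'I_n -> forest n}) :
  sigma q 'e_z = (\prod_(j < n) q j ^+ nvert (z j)) *:
                 'e_(\big[mmul/mone]_(j < n) z j) :> Ctrees k n.
Proof.
rewrite /sigma linextU -prod_basis; congr (_ *: _).
by apply: eq_bigr => j _; rewrite bvecE.
Qed.

(** A subset of a tree that avoids the root gives a term of the summand with
    [sigma q1] on the left: each of its vertices in branch [j] meets the root with
    color [j].  A subset that contains the root gives a term of the other summand,
    where the vertices of its complement meet the root. *)
Lemma Delta_is_coproduct : is_coproduct q1 q2 (Delta q1 q2).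
Proof.
move=> x /=; move: x; apply: linear_basis_eq.
- by apply: lin_comp; [exact: linearP | exact: linext_is_linear].
- have yL := lin_comp (linext_is_linear _) (linext_is_linear _).
  by apply: lin_add; apply: (lin_comp (linext_is_linear _)); apply: yL.
move=> z; rewrite map_ntensor_basis lambda_basis.
pose X j := poset_of (z j); have hX j : is_forest (X j) by apply: poset_ofP.
have -> : add_root_forests z = cls (add_root X).
  by rewrite /add_root_forests -clsE.
rewrite Delta_cls; last exact: add_root_forest.
pose w (A : {set {j : 'I_n & X j}}) : k :=
  \prod_j biweight q1 q2 (fiber j A) (fiber j (~: A)).
pose a (A : {set {j : 'I_n & X j}}) : {ffun 'I_n -> forest n} :=
  [ffun j => cl (fiber j A)].
have -> : tau (ntensor (fun j => Delta q1 q2 'e_(z j))) =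
    \sum_A w A *: 'e_(a A, a (~: A)).
  pose c j (B : {set X j}) := biweight q1 q2 B (~: B).
  pose y j (B : {set X j}) := (cl B, cl (~: B)).
  have -> : ntensor (fun j => Delta q1 q2 'e_(z j)) =
      ntensor (fun j => \sum_B c j B *: 'e_(y j B)).
    apply/malgP=> v; rewrite !mcoeff_ntensor; apply: eq_bigr => j _.
    by rewrite Delta_basis.
  rewrite ntensor_sum /tau linext_sum_basis; apply: eq_bigr => A _.
  rewrite bvecE; congr (_ *: 'e_(_, _)).
  - by apply: eq_bigr => j _; rewrite fiberC.
  - by apply/ffunP=> j; rewrite !ffunE.
  - by apply/ffunP=> j; rewrite !ffunE fiberC.
have mapE (f g : Ctrees_pow k n -> Ctrees k n) :
    map_tensor f g (\sum_A w A *: 'e_(a A, a (~: A))) =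
    \sum_A w A *: tensor (f 'e_(a A)) (g 'e_(a (~: A))).
  exact: map_tensor_sum.
have aE A j : a A j = cl (fiber j A) by rewrite ffunE.
have sE (q : 'I_n -> k) A : sigma q 'e_(a A) =
    (\prod_j q j ^+ #|fiber j A|) *: 'e_(\big[mmul/mone]_(j < n) cl (fiber j A)).
  rewrite sigma_basis.
  have -> : \big[mmul/mone]_(j < n) a A j = \big[mmul/mone]_(j < n) cl (fiber j A).
    by apply: eq_bigr => j _; rewrite aE.
  have -> : \prod_(j < n) q j ^+ nvert (a A j) = \prod_j q j ^+ #|fiber j A|.
    by apply: eq_bigr => j _; rewrite aE (nvert_cl _ (hX j)).
  by [].
rewrite /cop (@sum_option_set {j : 'I_n & X j}); congr (_ + _).
  rewrite mapE; apply: eq_bigr => A _; rewrite -/(above A) (aboveC A).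
  rewrite (biweight_above _ _ hX) (cl_above hX A) (cl_rooted_above hX (~: A)).
  rewrite sE lambda_basis -[X in tensor _ X]scale1r tensorZ mulr1 tensor_basis.
  by rewrite scalerA.
rewrite mapE; apply: eq_bigr => A _.
rewrite -/(above A) -/(rooted_above A) (rooted_aboveC A).
rewrite (biweight_rooted_above _ _ hX) (cl_above hX) (cl_rooted_above hX).
rewrite sE lambda_basis -[X in tensor X _]scale1r tensorZ mul1r tensor_basis.
by rewrite scalerA.
Qed.

End CoproductRecursion.

(** * Trees *)

Section Trees.
Variable n : nat.
Implicit Types (P Q : cposet n) (u : forest n).

Lemma is_rootedP P : is_forest P ->
  is_rooted P = [exists r, root_of [set: P] r].
Proof.
move=> hP; apply/existsP/existsP => -[r h]; exists r.
  by apply/root_ofP; split=> // v _; apply/implyP; have /forallP := h; apply.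
by apply/forallP=> v; apply/implyP; have /root_ofP[_] := h; apply; rewrite inE.
Qed.

Lemma root_of_imset P Q (f : P -> Q) (A : {set P}) r :
  is_forest P -> is_forest Q -> emb f -> root_of (f @: A) (f r) = root_of A r.
Proof.
move=> hP hQ ef; have fi := ef.1; have fl := emb_below _ _ hP hQ ef.
apply/root_ofP/root_ofP; rewrite mem_imset // => -[rA h]; split=> //.
  move=> v vA vr; rewrite -fl; apply: h; first exact: imset_f.
  by rewrite (inj_eq fi).
by move=> _ /imsetP[v vA ->]; rewrite (inj_eq fi) fl; apply: h.
Qed.

Lemma rooted_cl P (A : {set P}) : is_forest P ->
  is_rooted (poset_of (cl A)) = [exists r, root_of A r].
Proof.
move=> hP; have [f ef fA] := cl_emb A hP; have hA := poset_ofP (cl A).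
rewrite is_rootedP //; apply/existsP/existsP => -[r].
  by rewrite -(root_of_imset _ _ hA hP ef) fA; exists (f r).
move=> hr; have: r \in f @: [set: poset_of (cl A)].
  by rewrite fA; have /root_ofP[] := hr.
case/imsetP=> x _ rx; exists x.
by rewrite -(root_of_imset _ _ hA hP ef) fA -rx.
Qed.

Lemma rooted_cls P : is_forest P -> is_rooted (poset_of (cls P)) = is_rooted P.
Proof. by move=> hP; rewrite -cl_setT // rooted_cl // -is_rootedP. Qed.

Definition minimal P (A : {set P}) : {set P} :=
  [set v in A | [forall w in A, ~~ below w v]].

Lemma minimalP P (A : {set P}) v :
  reflect (v \in A /\ forall w, w \in A -> ~~ below w v) (v \in minimal A).
Proof.
rewrite inE; apply: (iffP andP) => -[vA h]; split=> //; first exact/forall_inP.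
exact/forall_inP.
Qed.

Lemma minimal_below P (A : {set P}) v : is_forest P -> v \in A ->
  exists2 r, r \in minimal A & (r == v) || below r v.
Proof.
move=> hP vA; have /is_forestP[h1 h2 _ _] := hP.
pose Q r := (r \in A) && ((r == v) || below r v).
have Qv : Q v by rewrite /Q vA eqxx.
have [r /andP[rA rv] rmin] := @arg_minnP P v Q (fun r => #|[set w | below w r]|) Qv.
exists r => //; apply/minimalP; split=> // w wA; apply/negP=> wr.
have /rmin : Q w.
  rewrite /Q wA; case/orP: rv => [/eqP <-|rv]; first by rewrite wr orbT.
  by rewrite (h2 _ _ _ wr rv) orbT.
rewrite leqNgt => /negP[]; apply: proper_card; apply/properP; split.
  by apply/subsetP=> z; rewrite !inE => zw; apply: h2 zw wr.
by exists w; rewrite inE ?h1.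
Qed.

Definition upset P (r : P) : {set P} := [set v | (v == r) || below r v].

Lemma root_upset P (r : P) : root_of (upset r) r.
Proof.
by apply/root_ofP; rewrite inE eqxx; split=> // v; rewrite inE => /predU1P[->|//] /eqP.
Qed.

Lemma upset_unrelated P (r : P) : is_forest P -> r \in minimal [set: P] ->
  unrelated (upset r) (~: upset r).
Proof.
move=> hP /minimalP[_ rmin]; have /is_forestP[h1 h2 h3 _] := hP.
apply/unrelatedP=> x y; rewrite !inE negb_or => rx /andP[yr ry].
split; apply/eqP; rewrite pcol_None //; apply/negP.
  by case/predU1P: rx ry => [->|rx] ry xy; rewrite ?xy ?(h2 _ _ _ rx xy) in ry.
have nyr : ~~ below y r by apply: rmin; rewrite inE.
case/predU1P: rx => [->|rx] yx; first by rewrite yx in nyr.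
by have := h3 x y r yx rx yr; rewrite (negbTE nyr) (negbTE ry).
Qed.

Lemma forest_split u : u != fempty n ->
  exists (t : tree n) v, u = funion t v.
Proof.
move=> u0; pose P := poset_of u; have hP : is_forest P := poset_ofP u.
have [x xP] : exists x : P, x \in [set: P].
  apply/set0Pn; apply: contra u0 => /eqP P0.
  by rewrite -[u]cls_poset -cl_setT // P0 cl_set0.
have [r rmin _] := minimal_below hP xP.
have ht : is_rooted (poset_of (cl (upset r))).
  by rewrite rooted_cl //; apply/existsP; exists r; apply: root_upset.
exists (exist (fun t => is_rooted (poset_of t)) (cl (upset r)) ht : tree n).
exists (cl (~: upset r)); rewrite -[LHS]cls_poset -cl_setT // -(setUCr (upset r)).
apply: cl_setU => //; last exact: upset_unrelated.
by rewrite -setI_eq0 setICr.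
Qed.

Lemma tree_neq0 (t : tree n) : (t : forest n) != fempty n.
Proof.
apply/eqP=> t0; have [r _] := existsP (valP t); have := nvert0 n.
by rewrite -t0 /nvert => /card0_eq/(_ r); rewrite inE.
Qed.

Lemma nvert_gt0 u : (0 < nvert u)%N = (u != fempty n).
Proof.
rewrite lt0n; congr negb; apply/eqP/eqP=> [/nvert_eq0 //|->]; exact: nvert0.
Qed.

Lemma tree_add_root (t : tree n) : exists2 x : {ffun 'I_n -> forest n},
  forest_of_tree t = add_root_forests x & forall j, (nvert (x j) < nvert t)%N.
Proof.
have hP := poset_ofP t; have := valP t; rewrite is_rootedP // => /existsP[r hr].
have tE := cl_add_root hP hr; rewrite cl_setT // cls_poset in tE.
eexists; first exact: tE.
move=> j; rewrite ffunE nvert_cl // /nvert -cardsT; apply: proper_card.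
apply/properP; split; first by apply/subsetP=> v; rewrite inE.
exists r; rewrite ?inE //=; apply/negP=> /eqP rr.
have := pcol_isSome r r hP; rewrite rr.
by have /is_forestP[->] := hP.
Qed.

End Trees.

Section Uniqueness.
Variables (k : fieldType) (n : nat) (q1 q2 : 'I_n -> k).

(** Induction on the number of vertices: the recursion gives the value on a tree
    from the values on its branches, and multiplicativity the rest. *)
Lemma coproduct_uniq (D : {lrmorphism Ctrees k n -> Ctrees2 k n}) :
  is_coproduct q1 q2 D -> D =1 Delta q1 q2.
Proof.
move=> cD; apply: linear_basis_eq; [exact: linearP | exact: linearP |].
have D0 := Delta_is_coproduct q1 q2.
move=> u; elim/ltn_ind: {u}(nvert u) {-2}u (erefl (nvert u)) => m IH u um.
have [->|/forest_split[t [v uE]]] := eqVneq u (fempty n).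
  have -> : 'e_(fempty n) = 1 :> Ctrees k n by rewrite -bvecE.
  by rewrite (rmorph1 D) (rmorph1 (Delta q1 q2)).
have t0 : (0 < nvert t)%N by rewrite nvert_gt0 tree_neq0.
have umE : m = (nvert t + nvert v)%N by rewrite -um uE nvert_union.
have -> : 'e_u = 'e_(forest_of_tree t) * 'e_v :> Ctrees k n.
  by rewrite malgU_mul uE.
rewrite (rmorphM D) (rmorphM (Delta q1 q2)); congr (_ * _); last first.
  by apply: (IH (nvert v)) => //; rewrite umE -{1}[nvert v]add0n ltn_add2r.
have [x tE xt] := tree_add_root t.
rewrite tE -lambda_basis.
apply: etrans (cD 'e_x) _; apply: etrans _ (esym (D0 'e_x)) => /=.
suff -> : map_ntensor D 'e_x = map_ntensor (Delta q1 q2) 'e_x by [].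
rewrite !map_ntensor_basis; apply/malgP=> z; rewrite !mcoeff_ntensor.
apply: eq_bigr => j _; rewrite (IH (nvert (x j))) //.
by rewrite umE; apply: leq_trans (xt j) _; apply: leq_addr.
Qed.

End Uniqueness.

(** * The dual product *)

Section DualProduct.
Variables (k : fieldType) (n : nat) (q1 q2 : 'I_n -> k).
Implicit Types (P Q : cposet n) (f g h : Cdual k n) (u : forest n).

Local Notation bw := (biweight q1 q2).

(** The value at [P] of the product of [f] and [g]. *)
Definition conv f g P : k :=
  \sum_(A : {set P}) bw A (~: A) * (f@_(cl A) * g@_(cl (~: A))).

Lemma pairing2_cop f g P : pairing2 f g (cop q1 q2 P) = conv f g P.
Proof.
have -> : pairing2 f g (cop q1 q2 P) =
    linext (V := k^o) (fun ab : forest n * forest n => f@_ab.1 * g@_ab.2)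
      (cop q1 q2 P) by [].
by rewrite /cop linext_sum_basis.
Qed.

Lemma pairing_linear f : linear (pairing f : Ctrees k n -> k^o).
Proof.
have -> : pairing f = linext (V := k^o) (fun u => f@_u) by [].
exact: linext_is_linear.
Qed.

Lemma pairing2_linear f g : linear (pairing2 f g : Ctrees2 k n -> k^o).
Proof.
have -> : pairing2 f g = linext (V := k^o)
  (fun ab : forest n * forest n => f@_ab.1 * g@_ab.2) by [].
exact: linext_is_linear.
Qed.

Lemma pairing_bvec f u : pairing f 'e_u = f@_u.
Proof. by rewrite -bvecE pairing_basis. Qed.

(** The number of vertices is additive, so [conv] vanishes at forests whose number
    of vertices is not a sum over the two supports; this makes the support finite. *)
Definition dual_mul f g : Cdual k n :=
  let E := seq_fset tt (flatten [seq forests_of n (nvert st.1 + nvert st.2)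
                         | st <- [seq (s, t) | s <- msupp f, t <- msupp g]]) in
  [malg u in E => conv f g (poset_of u)].

Lemma dual_mulE f g u : (dual_mul f g)@_u = conv f g (poset_of u).
Proof.
rewrite /dual_mul mcoeffE seq_fsetE; case: ifPn => // uE.
rewrite /conv big1 // => A _; have hP := poset_ofP u.
case: (msuppP f) => [sf|]; last by rewrite mul0r mulr0.
case: (msuppP g) => [sg|]; last by rewrite mulr0 mulr0.
case/negP: uE; apply/flatten_mapP; exists (cl A, cl (~: A)).
  by apply/allpairsP; exists (cl A, cl (~: A)); split.
by rewrite mem_forests_of /= !nvert_cl // cardsC.
Qed.

Lemma dual_mul_is_dual : is_dual_product (Delta q1 q2) dual_mul.
Proof.
move=> f g; apply: (@linear_basis_eq _ _ k^o).
- exact: pairing_linear.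
- by apply: (lin_comp (pairing2_linear f g)); apply: linearP.
by move=> u; rewrite pairing_bvec dual_mulE Delta_basis pairing2_cop.
Qed.

Section Mul.
Variables (mul : Cdual k n -> Cdual k n -> Cdual k n).
Hypothesis mulE : forall f g u, (mul f g)@_u = conv f g (poset_of u).

Local Notation one := (Dbasis k (fempty n)).

Lemma mul_cl f g P (A : {set P}) : is_forest P ->
  (mul f g)@_(cl A) = \sum_(B : {set P} | B \subset A)
     bw B (A :\: B) * (f@_(cl B) * g@_(cl (A :\: B))).
Proof.
move=> hP; rewrite mulE /conv; have [m em mA] := cl_emb A hP.
have hA := poset_ofP (cl A); have mi := em.1.
have mIn y : m y \in A.
  have : m y \in m @: [set: poset_of (cl A)] by rewrite imset_f ?inE.
  by rewrite mA.
have mEx x : x \in A -> exists y, x = m y.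
  move=> xA; have : x \in m @: [set: poset_of (cl A)] by rewrite mA.
  by case/imsetP=> y _ ->; exists y.
have mS (B : {set poset_of (cl A)}) : m @: B \subset A.
  by apply/subsetP=> _ /imsetP[y _ ->].
have mK (B : {set poset_of (cl A)}) : m @^-1: (m @: B) = B.
  by apply/setP=> x; rewrite inE mem_imset.
rewrite [RHS](reindex_onto (fun B : {set poset_of (cl A)} => m @: B)
                           (fun B => m @^-1: B)) /=; last first.
  move=> B /subsetP BA; apply/setP=> x; apply/imsetP/idP=> [[y]|xB].
    by rewrite inE => ? ->.
  by have [y xy] := mEx _ (BA _ xB); exists y; rewrite ?inE -?xy.
apply: eq_big => [B|B _]; first by rewrite mS mK eqxx.
have -> : A :\: m @: B = m @: (~: B).
  apply/setP=> x; rewrite inE; apply/andP/imsetP=> [[xB /mEx[y xy]]|[y yB ->]].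
    by exists y => //; rewrite inE; apply: contra xB => yB; rewrite xy imset_f.
  by split; [rewrite mem_imset // -in_setC | apply: mIn].
by rewrite (biweight_imset _ _ _ _ em) 2!(cl_imset _ hA hP em).
Qed.

(** Both sides sum over the ways to cut the vertices into three parts; the terms
    agree by [biweight_assoc]. *)
Lemma mulA_dual : associative mul.
Proof.
move=> f g h; apply/malgP=> u; have hP := poset_ofP u.
rewrite !mulE /conv; set P := poset_of u in hP *.
transitivity (\sum_(A : {set P}) \sum_(B : {set P} | B \subset ~: A)
    (bw A (~: A) * bw B (~: A :\: B)) *
    (f@_(cl A) * (g@_(cl B) * h@_(cl (~: A :\: B))))).
  apply: eq_bigr => A _; rewrite (mul_cl _ _ _ hP) !mulr_sumr.
  by apply: eq_bigr => B _; rewrite -[RHS]mulrA; congr (_ * _); rewrite mulrCA.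
transitivity (\sum_(A : {set P}) \sum_(C : {set P} | A \subset C)
    (bw C (~: C) * bw A (C :\: A)) *
    (f@_(cl A) * (g@_(cl (C :\: A)) * h@_(cl (~: C))))); last first.
  rewrite (exchange_big_dep xpredT) //=; apply: eq_bigr => C _.
  rewrite (mul_cl _ _ _ hP) mulr_suml mulr_sumr.
  by apply: eq_bigr => A _; rewrite !mulrA.
apply: eq_bigr => A _.
rewrite [RHS](reindex_onto (fun B => A :|: B) (fun C => C :\: A)) /=; last first.
  by move=> C AC; rewrite setDE setUIr setUCr setIT; apply/setUidPr.
have dK (B : {set P}) : (A :|: B) :\: A = B :\: A by rewrite setDUl setDv set0U.
apply: eq_big => [B|B BA].
  by rewrite subsetUl dK /= -disjoints_subset; apply/idP/eqP => [/setDidPl|/setDidPl].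
have dAB : [disjoint A & B] by rewrite disjoint_sym disjoints_subset.
have dBC : [disjoint B & ~: A :\: B] by rewrite -setI_eq0 setDE setICA setICr setI0.
have -> : (A :|: B) :\: A = B by rewrite dK; apply/setDidPl; rewrite disjoint_sym.
have -> : ~: (A :|: B) = ~: A :\: B by rewrite setCU setDE.
rewrite (biweight_assoc _ _ dAB dBC); congr (bw _ _ * _ * _).
by rewrite setDE setUIr setUCr setIT; apply/esym/setUidPr.
Qed.

Lemma mulBf_linear f : linear (mul f).
Proof.
move=> a g h; apply/malgP=> u; rewrite mcoeffD mcoeffZ !mulE /conv mulr_sumr.
rewrite -big_split; apply: eq_bigr => A _ /=.
by rewrite mcoeffD mcoeffZ !mulrDr 2!(mulrCA _ a).
Qed.

Lemma mulBl_linear f : linear (mul^~ f).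
Proof.
move=> a g h; apply/malgP=> u; rewrite mcoeffD mcoeffZ !mulE /conv mulr_sumr.
rewrite -big_split; apply: eq_bigr => A _ /=.
by rewrite mcoeffD mcoeffZ mulrDl mulrDr -(mulrA a) (mulrCA _ a).
Qed.

Lemma conv_one_l f P : is_forest P -> conv one f P = f@_(cls P).
Proof.
move=> hP; rewrite /conv (bigD1 set0) //= big1 ?addr0 => [|A A0].
  rewrite biweight_set0 setC0 cl_setT // cl_set0 // /Dbasis bvecE mcoeff_basis.
  by rewrite eqxx !mul1r.
rewrite /Dbasis bvecE mcoeff_basis eq_sym cl_eq_empty // (negbTE A0).
by rewrite mul0r mulr0.
Qed.

Lemma conv_one_r f P : is_forest P -> conv f one P = f@_(cls P).
Proof.
move=> hP; rewrite /conv (bigD1 setT) //= big1 ?addr0 => [|A A0].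
  rewrite setCT biweight_set0r cl_setT // cl_set0 // /Dbasis bvecE mcoeff_basis.
  by rewrite eqxx mul1r mulr1.
rewrite /Dbasis bvecE mcoeff_basis eq_sym cl_eq_empty //.
have /negbTE -> : ~: A != set0.
  by apply: contra A0 => /eqP A0; rewrite -[A]setCK A0 setC0.
by rewrite !mulr0.
Qed.

Lemma dual_algebra : is_algebra mul one.
Proof.
split; first by split; [exact: mulBl_linear | exact: mulBf_linear].
- exact: mulA_dual.
- by move=> f; apply/malgP=> u; rewrite mulE conv_one_l ?cls_poset ?poset_ofP.
- by move=> f; apply/malgP=> u; rewrite mulE conv_one_r ?cls_poset ?poset_ofP.
Qed.

Lemma mul_basis (s t : forest n) u : (mul 'e_s 'e_t)@_u =
  \sum_(A : {set poset_of u} | (cl A == s) && (cl (~: A) == t)) bw A (~: A).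
Proof.
rewrite mulE /conv [RHS]big_mkcond; apply: eq_bigr => A _.
rewrite !mcoeff_basis ![_ == cl _]eq_sym.
by case: eqP; case: eqP => _ _; rewrite /= ?mulr1 ?mul0r ?mulr0.
Qed.

(** ** The Lie algebra of trees *)

Lemma mcoeff_linear (K : choiceType) (u : K) :
  linear ((fun x => x@_u) : {malg k[K]} -> k^o).
Proof. by move=> a x y; rewrite mcoeffD mcoeffZ. Qed.

Lemma incl_linear : linear (@incl k n).
Proof. exact: linext_is_linear. Qed.

Lemma incl_basis (t : tree n) : incl 'e_t = 'e_(forest_of_tree t) :> Cdual k n.
Proof. by rewrite /incl linextU /Dbasis bvecE. Qed.

Lemma mcoeff_incl_tree (x : treeL k n) (t : tree n) :
  (incl x)@_(forest_of_tree t) = x@_t.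
Proof.
move: x; apply: (@linear_basis_eq _ _ k^o).
- exact: (lin_comp (@mcoeff_linear _ (forest_of_tree t)) incl_linear).
- exact: mcoeff_linear.
move=> s; rewrite incl_basis !mcoeff_basis; case: (s =P t) => [->|st].
  by rewrite eqxx.
by case: eqP => // /val_inj.
Qed.

Lemma mcoeff_incl_not_tree (x : treeL k n) u :
  ~~ is_rooted (poset_of u) -> (incl x)@_u = 0.
Proof.
move=> nu; move: x; apply: (@linear_basis_eq _ _ k^o).
- exact: (lin_comp (@mcoeff_linear _ u) incl_linear).
- by move=> a x y; rewrite scaler0 addr0.
move=> s; rewrite incl_basis mcoeff_basis; case: eqP nu => // <-.
by rewrite (valP s).
Qed.

Lemma incl_inj (x y : treeL k n) : incl x = incl y -> x = y.
Proof. by move=> xy; apply/malgP=> t; rewrite -!mcoeff_incl_tree xy. Qed.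

(** The trees outside the range of summation in [star] have the wrong number of
    vertices to be cut into [s] and [t]. *)
Lemma mcoeff_star (s t w : tree n) :
  (star q1 q2 s t)@_w =
  (mul 'e_(forest_of_tree s) 'e_(forest_of_tree t))@_(forest_of_tree w).
Proof.
have hP := poset_ofP w; rewrite mul_basis /star mcoeff_sum.
pose c (v : tree n) := \sum_(A : {set poset_of v} |
  iso (subforest A) (poset_of s) && iso (subforest (~: A)) (poset_of t))
  qweight q1 q2 A.
have cE : c w = \sum_(A : {set poset_of w} | (cl A == forest_of_tree s) &&
    (cl (~: A) == forest_of_tree t)) bw A (~: A).
  apply: eq_big => [A|A _]; first by rewrite !cl_eqP.
  by rewrite biweightE.
have sE (v : tree n) : (c v *: << v >>)@_w = c v * (v == w)%:R.
  by rewrite mcoeffZ bvecE mcoeff_basis.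
rewrite (eq_bigr _ (fun v _ => sE v)) -cE.
case wm: (w \in trees_of n (nvert s + nvert t)).
  rewrite (bigD1_seq w) ?trees_of_uniq //= eqxx mulr1 big1 ?addr0 // => v /negbTE ->.
  by rewrite mulr0.
rewrite big1_seq => [|v /andP[_ vm]]; last first.
  by case: eqP wm vm => [<- ->|_ _ _]; rewrite ?mulr0.
rewrite cE big1 // => A /andP[/eqP As /eqP At].
have := mem_trees_of (nvert s + nvert t) w; rewrite wm => /esym/negP[].
by rewrite -As -At !nvert_cl // cardsC.
Qed.

(** The roots [r] and [r'] are incomparable, as the lower one would be a root of
    [P], while any relation between the two sets would make them comparable. *)
Lemma tree_pair_unrelated P (A : {set P}) r r' :
  is_forest P -> root_of A r -> root_of (~: A) r' -> ~~ is_rooted P ->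
  unrelated A (~: A).
Proof.
move=> hP /root_ofP[rA rmin] /root_ofP[r'A r'min] nP.
have /is_forestP[h1 h2 h3 _] := hP.
have rr' : r != r' by apply/eqP=> e; move: r'A; rewrite -e inE rA.
have le x : x \in A -> (x == r) || below r x.
  by move=> xA; have [//|xr] := eqVneq x r; rewrite rmin.
have le' x : x \in ~: A -> (x == r') || below r' x.
  by move=> xA; have [//|xr] := eqVneq x r'; rewrite r'min.
have nrr' : ~~ below r r' /\ ~~ below r' r.
  split; apply: contra nP => lr; rewrite is_rootedP //; apply/existsP.
    exists r; apply/root_ofP; split=> // v _ vr.
    have [vA|] := boolP (v \in A); first exact: rmin.
    by rewrite -in_setC => /le'/predU1P[->|/(h2 _ _ _ lr)].
  exists r'; apply/root_ofP; split=> // v _ vr.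
  have [/le/predU1P[->|/(h2 _ _ _ lr)]|] := boolP (v \in A) => //.
  by rewrite -in_setC => /r'min; apply.
have no x y z : (x == r) || below r x -> (y == r') || below r' y ->
    (x == z) || below x z -> (y == z) || below y z -> False.
  move=> rx r'y xz yz; case: nrr' => nr nr'.
  have le_trans (a b c : P) : (b == a) || below a b -> (b == c) || below b c ->
      (c == a) || below a c.
    case/predU1P=> [->|ab]; first by rewrite eq_sym.
    by case/predU1P=> [<-|bc]; apply/orP; right=> //; apply: h2 ab bc.
  have := le_trans _ _ _ rx xz; have := le_trans _ _ _ r'y yz.
  case/predU1P=> [->|r'z] /predU1P[rz|rz].
  - by rewrite rz eqxx in rr'.
  - by rewrite rz in nr.
  - by rewrite rz in r'z; rewrite r'z in nr'.
  - by have := h3 z r r' rz r'z rr'; rewrite (negbTE nr) (negbTE nr').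
apply/unrelatedP=> x y /le rx /le' ry; split; apply/eqP; rewrite pcol_None //.
  by apply/negP=> xy; apply: (no x y y); rewrite ?xy ?eqxx ?orbT.
by apply/negP=> yx; apply: (no x y x); rewrite ?yx ?eqxx ?orbT.
Qed.

Lemma tree_root (t : tree n) P (A : {set P}) :
  is_forest P -> cl A = forest_of_tree t -> exists r, root_of A r.
Proof.
move=> hP At; have := valP t; rewrite /= -[val t]/(forest_of_tree t) -At.
by rewrite rooted_cl // => /existsP.
Qed.

(** Off the trees, the products of two trees in either order agree: each counts
    the ways to write a forest as the disjoint union of the two. *)
Lemma mul_tree_comm (s t : tree n) u : ~~ is_rooted (poset_of u) ->
  (mul 'e_(forest_of_tree s) 'e_(forest_of_tree t))@_u =
  (mul 'e_(forest_of_tree t) 'e_(forest_of_tree s))@_u.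
Proof.
move=> nu; have hP := poset_ofP u; rewrite !mul_basis.
have w1 (t1 t2 : tree n) (A : {set poset_of u}) :
    (cl A == forest_of_tree t1) && (cl (~: A) == forest_of_tree t2) -> bw A (~: A) = 1.
  case/andP=> /eqP /(tree_root hP)[r hr] /eqP /(tree_root hP)[r' hr'].
  by apply: biweight_unrelated; apply: tree_pair_unrelated hr hr' nu.
transitivity (\sum_(A : {set poset_of u} | (cl A == forest_of_tree s) &&
    (cl (~: A) == forest_of_tree t)) (1 : k)).
  by apply: eq_bigr => A; apply: w1.
transitivity (\sum_(A : {set poset_of u} | (cl A == forest_of_tree t) &&
    (cl (~: A) == forest_of_tree s)) (1 : k)); last first.
  by apply/esym/eq_bigr => A; apply: w1.
rewrite [RHS](reindex_inj (inv_inj (@setCK _))) /=.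
by apply: eq_bigl => A; rewrite setCK [LHS]andbC; reflexivity.
Qed.

Lemma bracketE (s t : tree n) : bracket q1 q2 'e_s 'e_t = star q1 q2 s t - star q1 q2 t s.
Proof. by rewrite /bracket !linextU. Qed.

Lemma bracket_bilinear : is_bilinear (bracket q1 q2).
Proof.
split=> [y|x]; first exact: linext_is_linear.
by apply: linext_linearr => s; apply: linext_is_linear.
Qed.

Lemma incl_bracket_basis (s t : tree n) :
  incl (bracket q1 q2 'e_s 'e_t) =
  mul (incl 'e_s) (incl 'e_t) - mul (incl 'e_t) (incl 'e_s).
Proof.
rewrite bracketE !incl_basis; apply/malgP=> u; rewrite mcoeffB.
have [ru|nu] := boolP (is_rooted (poset_of u)); last first.
  by rewrite (mcoeff_incl_not_tree _ nu) (mul_tree_comm _ _ nu) subrr.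
pose w : tree n := exist (fun v => is_rooted (poset_of v)) u ru.
transitivity ((star q1 q2 s t - star q1 q2 t s)@_w).
  exact: (mcoeff_incl_tree _ w).
rewrite mcoeffB.
exact: (congr2 (fun a b => a - b) (mcoeff_star s t w) (mcoeff_star t s w)).
Qed.

Lemma incl_lie_map : is_lie_map (bracket q1 q2) mul (@incl k n).
Proof.
split; first exact: incl_linear.
have [bl br] := bracket_bilinear.
move=> x y; move: x; apply: linear_basis_eq.
- exact: (lin_comp incl_linear (bl y)).
- apply: lin_sub.
    exact: (lin_comp (mulBl_linear _) incl_linear).
  exact: (lin_comp (mulBf_linear _) incl_linear).
move=> s; move: y; apply: linear_basis_eq.
- exact: (lin_comp incl_linear (br _)).
- apply: lin_sub.
    exact: (lin_comp (mulBf_linear _) incl_linear).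
  exact: (lin_comp (mulBl_linear _) incl_linear).
exact: incl_bracket_basis.
Qed.

(** The identities hold for the commutator in the dual, and [incl] is injective. *)
Lemma tree_lie_algebra : is_lie_algebra (bracket q1 q2).
Proof.
split; first exact: bracket_bilinear.
  by move=> x; apply: incl_inj; rewrite incl_lie_map.2 subrr (lin0 incl_linear).
move=> x y z; apply: incl_inj; rewrite !(linD incl_linear) (lin0 incl_linear).
pose c f g := mul f g - mul g f.
have ic (a b d : treeL k n) : incl (bracket q1 q2 a (bracket q1 q2 b d)) =
    c (incl a) (c (incl b) (incl d)).
  apply: etrans (incl_lie_map.2 _ _) _.
  exact: (congr1 (c (incl a)) (incl_lie_map.2 b d)).
apply: etrans (congr2 +%R (congr2 +%R (ic x y z) (ic y z x)) (ic z x y)) _.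
exact: (commutator_jacobi dual_algebra).
Qed.


(** ** Primitive elements *)

Lemma rooted_funion u v : is_rooted (poset_of (funion u v)) ->
  u = fempty n \/ v = fempty n.
Proof.
have [hu hv] := (poset_ofP u, poset_ofP v).
have hU := disj_union_forest hu hv.
rewrite -{1}[u]cls_poset -{1}[v]cls_poset -cls_disj_union // rooted_cls //.
case/existsP=> -[r|r] /forallP h; [right | left]; apply: nvert_eq0; apply: eq_card0.
  by move=> y; have := h (inr y).
by move=> y; have := h (inl y).
Qed.

Lemma mcoeff_incl_empty (x : treeL k n) : (incl x)@_(fempty n) = 0.
Proof.
apply: mcoeff_incl_not_tree; apply/negP=> r.
by have := tree_neq0 (exist (fun v => is_rooted (poset_of v)) _ r : tree n); rewrite eqxx.
Qed.

Lemma incl_primitive (x : treeL k n) : is_primitive (incl x).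
Proof.
pose f := incl x; pose c : Ctrees k n -> k := @counit k n.
have cL : linear (c : Ctrees k n -> k^o) by apply: mcoeff_linear.
have pL : linear (pairing f : Ctrees k n -> k^o) by apply: pairing_linear.
have mL (y : Ctrees k n) : linear (fun z : Ctrees k n => z * y).
  by move=> a z z'; rewrite mulrDl -scalerAl.
have mR (y : Ctrees k n) : linear (fun z : Ctrees k n => y * z).
  by move=> a z z'; rewrite mulrDr -scalerAr.
have sL (g : Ctrees k n -> k) a : linear (g : Ctrees k n -> k^o) ->
    linear ((fun z => g z * a) : Ctrees k n -> k^o).
  by move=> gL b z z'; rewrite gL mulrDl; congr (_ + _); apply/esym/mulrA.
have sR (g : Ctrees k n -> k) a : linear (g : Ctrees k n -> k^o) ->
    linear ((fun z => a * g z) : Ctrees k n -> k^o).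
  by move=> gL b z z'; rewrite gL mulrDr; congr (_ + _); apply: mulrCA.
move=> y z; rewrite -/f -/(c y) -/(c z); move: y.
apply: (@linear_basis_eq _ _ k^o).
- exact: (lin_comp pL (mL z)).
- by apply: lin_add; apply: sL.
move=> u; move: z; apply: (@linear_basis_eq _ _ k^o).
- exact: (lin_comp pL (mR 'e_u)).
- by apply: lin_add; apply: sR.
move=> v; rewrite malgU_mul -[mmul u v]/(funion u v) !pairing_bvec.
rewrite /c /counit !mcoeff_basis.
have [-> |u0] := eqVneq u (fempty n).
  rewrite fempty_union mul1r mcoeff_incl_empty.
  by rewrite mul0r add0r.
have [-> |v0] := eqVneq v (fempty n).
  by rewrite funion_empty mulr1 mul0r addr0.
rewrite mulr0 mul0r addr0; apply: mcoeff_incl_not_tree.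
by apply/negP=> /rooted_funion[] e; rewrite e eqxx in u0 v0.
Qed.

End Mul.
End DualProduct.

(** * Factorization of forests into trees *)

Section Factorization.
Variable n : nat.
Implicit Types (P Q : cposet n) (u : forest n) (t : tree n) (ts : seq (tree n)).

Lemma minimal_imset P Q (f : P -> Q) (A : {set P}) :
  is_forest P -> is_forest Q -> emb f -> minimal (f @: A) = f @: minimal A.
Proof.
move=> hP hQ ef; have fi := ef.1; have fl := emb_below _ _ hP hQ ef.
apply/setP=> y; apply/minimalP/imsetP=> [[/imsetP[x xA ->] h]|[x /minimalP[xA h] ->]].
  exists x => //; apply/minimalP; split=> // w wA.
  by rewrite -fl; apply: h; apply: imset_f.
split; first exact: imset_f.
by move=> _ /imsetP[w wA ->]; rewrite fl; apply: h.
Qed.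

Lemma upset_imset P Q (f : P -> Q) r :
  is_forest P -> is_forest Q -> emb f ->
  (forall y, below (f r) y -> y \in f @: [set: P]) ->
  upset (f r) = f @: upset r.
Proof.
move=> hP hQ ef h; have fi := ef.1; have fl := emb_below _ _ hP hQ ef.
apply/setP=> y; rewrite inE; apply/idP/imsetP=> [/predU1P[->|ry]|[x + ->]].
- by exists r; rewrite ?inE ?eqxx.
- have /imsetP[x _ yx] := h y ry; exists x => //.
  by rewrite inE -fl -yx ry orbT.
by rewrite inE (inj_eq fi) fl.
Qed.

(** Components are represented by their roots. *)
Definition ncomp (p : pred (forest n)) P : nat :=
  #|[set r in minimal [set: P] | p (cl (upset r))]|.

Definition nroots P : nat := #|minimal [set: P]|.

Lemma nrootsE P : nroots P = ncomp predT P.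
Proof. by apply: eq_card => r; rewrite !inE andbT. Qed.

Lemma ncomp_emb p P Q (f : P -> Q) : is_forest P -> is_forest Q ->
  emb f -> bijective f -> ncomp p P = ncomp p Q.
Proof.
move=> hP hQ ef bf; have fi := ef.1.
have fT : f @: [set: P] = [set: Q].
  case: bf => g fK gK; apply/setP=> y; rewrite inE.
  by apply/imsetP; exists (g y).
rewrite /ncomp -(card_imset _ fi); apply: eq_card => y.
rewrite [in RHS]inE -fT minimal_imset //; apply/imsetP/andP=> [[r]|].
  rewrite inE => /andP[rm pr] ->; split; first exact: imset_f.
  by rewrite upset_imset ?cl_imset // => z _; rewrite fT inE.
case=> /imsetP[r rm ->]; rewrite upset_imset ?cl_imset // => [pr|z _].
  by exists r; rewrite // inE rm.
by rewrite fT inE.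
Qed.

Lemma ncomp_cls p P : is_forest P -> ncomp p (poset_of (cls P)) = ncomp p P.
Proof.
move=> hP; have [f ef bf] := cls_emb hP; apply: ncomp_emb ef bf => //.
exact: poset_ofP.
Qed.

Lemma ncomp_disj_union p P Q : is_forest P -> is_forest Q ->
  ncomp p (disj_union P Q) = (ncomp p P + ncomp p Q)%N.
Proof.
move=> hP hQ; have hU := disj_union_forest hP hQ.
have el := emb_inl hP hQ; have er := emb_inr hP hQ.
have minP (R : cposet n) (x : R) :
    reflect (forall w, ~~ below w x) (x \in minimal [set: R]).
  apply: (iffP (minimalP _ _)) => [[_ h] w|h]; first by apply: h; rewrite inE.
  by rewrite inE; split=> // w _; apply: h.
have minl x : (inl x \in minimal [set: disj_union P Q]) = (x \in minimal [set: P]).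
  by apply/minP/minP => [h w|h [w|w]] //; [exact: (h (inl w)) | exact: (h w)].
have minr x : (inr x \in minimal [set: disj_union P Q]) = (x \in minimal [set: Q]).
  by apply/minP/minP => [h w|h [w|w]] //; [exact: (h (inr w)) | exact: (h w)].
have upl x : cl (upset (inl x : disj_union P Q)) = cl (upset x).
  rewrite (upset_imset hP hU el) ?(cl_imset _ hP hU el) // => -[y|//] _.
  exact: imset_f.
have upr x : cl (upset (inr x : disj_union P Q)) = cl (upset x).
  rewrite (upset_imset hQ hU er) ?(cl_imset _ hQ hU er) // => -[//|y] _.
  exact: imset_f.
rewrite /ncomp -!sum1_card big_mkcond big_sumType -!big_mkcond /=.
have inS (R : cposet n) (x : R) :
    (x \in [set r in minimal [set: R] | p (cl (upset r))]) =
    (x \in minimal [set: R]) && p (cl (upset x)) by rewrite in_set.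
congr (_ + _)%N; apply: eq_bigl => x.
  by rewrite [LHS](inS (disj_union P Q) (inl x)) minl upl inS.
by rewrite [LHS](inS (disj_union P Q) (inr x)) minr upr inS.
Qed.

Lemma ncomp_funion p u v :
  ncomp p (poset_of (funion u v)) = (ncomp p (poset_of u) + ncomp p (poset_of v))%N.
Proof.
have [hu hv] := (poset_ofP u, poset_ofP v).
rewrite -ncomp_disj_union // -(ncomp_cls p (disj_union_forest hu hv)).
by rewrite cls_disj_union // !cls_poset.
Qed.

Lemma ncomp_empty p : ncomp p (poset_of (fempty n)) = 0%N.
Proof.
rewrite -cls_empty ncomp_cls; last exact: empty_forest.
by apply: eq_card0 => -[].
Qed.

Lemma ncomp_tree p t : ncomp p (poset_of t) = p (forest_of_tree t).
Proof.
have hP := poset_ofP t; have := valP t; rewrite is_rootedP // => /existsP[r hr].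
have /root_ofP[_ rmin] := hr; have /is_forestP[h1 h2 _ _] := hP.
have rm : r \in minimal [set: poset_of t].
  apply/minimalP; rewrite inE; split=> // w _; apply/negP=> wr.
  have [e|/(rmin w)] := eqVneq w r; first by rewrite e h1 in wr.
  by rewrite inE => /(_ isT) rw; have := h1 r; rewrite (h2 _ _ _ rw wr).
have upE : upset r = [set: poset_of t].
  apply/setP=> v; rewrite !inE; have [//|/(rmin v)] := eqVneq v r.
  by rewrite inE => ->.
have pE : p (cl (upset r)) = p (forest_of_tree t) by rewrite upE cl_setT // cls_poset.
have uniq_min v : v \in minimal [set: poset_of t] -> v = r.
  case/minimalP=> _ h; apply/eqP; apply: contraT => vr.
  by have := h r; rewrite rmin ?inE // => /(_ isT).
rewrite /ncomp; case pt: (p (forest_of_tree t)).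
  apply: (etrans _ (cards1 r)); apply: eq_card => v; rewrite in_set1 in_set.
  by apply/andP/eqP=> [[/uniq_min]|->] //; rewrite pE pt.
apply: eq_card0 => v; rewrite in_set; apply/negP=> /andP[/uniq_min ->].
by rewrite pE pt.
Qed.

Definition tree_prod ts : forest n := foldr (fun t u => funion t u) (fempty n) ts.

Lemma ncomp_tree_prod p ts :
  ncomp p (poset_of (tree_prod ts)) = count p (map (@forest_of_tree n) ts).
Proof.
by elim: ts => [|t ts IH] /=; rewrite ?ncomp_empty // ncomp_funion IH ncomp_tree.
Qed.

Lemma nroots_tree_prod ts : nroots (poset_of (tree_prod ts)) = size ts.
Proof. by rewrite nrootsE ncomp_tree_prod count_predT size_map. Qed.

(** The letters with a given property can be counted in the product, as the
    components with that property. *)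
Lemma tree_prod_inj ts ts' : tree_prod ts = tree_prod ts' -> perm_eq ts ts'.
Proof.
move=> e; apply: (perm_map_inj (f := @forest_of_tree n) val_inj); apply/permP=> p.
by rewrite -!ncomp_tree_prod e.
Qed.

Lemma tree_prod_surj u : exists ts, tree_prod ts == u.
Proof.
elim/ltn_ind: {u}(nvert u) {-2}u (erefl (nvert u)) => m IH u um.
have [->|/forest_split[t [v uE]]] := eqVneq u (fempty n); first by exists [::].
have t0 : (0 < nvert t)%N by rewrite nvert_gt0 tree_neq0.
have [|ts /eqP tsE] := IH (nvert v) _ v erefl.
  by rewrite -um uE nvert_union -{1}[nvert v]add0n ltn_add2r.
by exists (t :: ts); rewrite /= tsE -uE.
Qed.

(** The components of [u], in an order that depends only on [u]. *)
Definition factors u : seq (tree n) := xchoose (tree_prod_surj u).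

Lemma factorsK u : tree_prod (factors u) = u.
Proof. exact/eqP/(xchooseP (tree_prod_surj u)). Qed.

Lemma perm_factors ts : perm_eq ts (factors (tree_prod ts)).
Proof. by apply: tree_prod_inj; rewrite factorsK. Qed.

Lemma nroots_cl P (A : {set P}) : is_forest P ->
  nroots (poset_of (cl A)) = #|minimal A|.
Proof.
move=> hP; have [f ef fA] := cl_emb A hP; have hA := poset_ofP (cl A).
rewrite /nroots -(card_imset _ ef.1) -(minimal_imset _ hA hP ef).
by apply: eq_card => x; rewrite fA.
Qed.

(** The only root of [P] that a tree [A] can contain is its own.  If the number of
    roots drops, then [A] does contain one and removing [A] creates none, so [A] is
    a component. *)
Lemma remove_tree_roots (P : cposet n) (A : {set P}) r : is_forest P -> root_of A r ->
  (nroots P <= (#|minimal (~: A)|).+1)%N /\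
  ((#|minimal (~: A)| < nroots P)%N -> unrelated A (~: A)).
Proof.
move=> hP hr; have /root_ofP[rA rmin] := hr.
have /is_forestP[h1 h2 h3 _] := hP.
have sub : minimal [set: P] \subset r |: minimal (~: A).
  apply/subsetP=> v /minimalP[_ vmin]; rewrite in_setU1.
  have [vA|vA] := boolP (v \in A); last first.
    apply/orP; right; apply/minimalP; rewrite inE; split=> // w _.
    by apply: vmin; rewrite inE.
  apply/orP; left; apply: contraT => vr; have := vmin r; rewrite inE rmin //.
  by move=> /(_ isT).
have rn : r \notin minimal (~: A).
  by apply/negP=> /minimalP[]; rewrite inE rA.
have card1 : #|r |: minimal (~: A)| = (#|minimal (~: A)|).+1.
  by rewrite cardsU1 rn.
split=> [|lt]; first by rewrite -card1; apply: subset_leq_card.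
have eqm : minimal [set: P] = r |: minimal (~: A).
  by apply/eqP; rewrite eqEcard sub card1.
have minP v : v \in minimal [set: P] -> forall w, ~~ below w v.
  by case/minimalP=> _ h w; apply: h; rewrite inE.
have rm : forall w, ~~ below w r by apply: minP; rewrite eqm setU11.
have le x : x \in A -> (r == x) || below r x.
  by move=> xA; rewrite eq_sym; have [//|xr] := eqVneq x r; rewrite rmin.
have no x y : x \in A -> y \in ~: A -> ~~ below x y.
  move=> xA yA; apply/negP=> xy.
  have [z zmin zy] := minimal_below hP yA.
  have zm : forall w, ~~ below w z by apply: minP; rewrite eqm in_setU1 zmin orbT.
  have rz : r != z by apply: contraNneq rn => ->.
  have ry : below r y by case/predU1P: (le x xA) => [->|/(h2 _ _ _)]; last apply.
  case/predU1P: zy => [zE|zy]; first by have := zm r; rewrite zE ry.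
  by have := h3 y r z ry zy rz; rewrite (negbTE (zm r)) (negbTE (rm z)).
apply/unrelatedP=> x y xA yA; split; apply/eqP; rewrite pcol_None //; first exact: no.
apply/negP=> yx; have yr : y != r by apply: contraTneq yA => ->; rewrite inE rA.
case/predU1P: (le x xA) => [rx|rx]; first by have := rm y; rewrite rx yx.
have := h3 x y r yx rx yr; rewrite (negbTE (rm y)) /=.
by have /negbTE -> := no r y rA yA.
Qed.

Lemma funion_split u v : exists2 A : {set poset_of (funion u v)},
  cl A = u & cl (~: A) = v.
Proof.
have [hu hv] := (poset_ofP u, poset_ofP v).
have hU := disj_union_forest hu hv; have hF := poset_ofP (funion u v).
have : iso (disj_union (poset_of u) (poset_of v)) (poset_of (funion u v)).
  by rewrite iso_sym; apply: funionE.
case/isoP=> f fi; have ef := iso_emb hU fi; have [bf _ _] := fi.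
exists (f @: (inl @: [set: poset_of u])).
  by rewrite (cl_imset _ hU hF ef) (cl_imset _ hu hU (emb_inl hu hv)) cl_setT
    // cls_poset.
rewrite (imsetC_bij _ bf) (cl_imset _ hU hF ef).
have -> : ~: (inl @: [set: poset_of u]) = inr @: [set: poset_of v]
    :> {set disj_union (poset_of u) (poset_of v)}.
  apply/setP=> -[x|x]; rewrite inE.
    rewrite [inl x \in _]imset_f ?inE //.
    by apply/esym/imsetP=> -[].
  rewrite [RHS]imset_f ?inE //.
  by apply/imsetP=> -[].
by rewrite (cl_imset _ hv hU (emb_inr hu hv)) cl_setT // cls_poset.
Qed.

End Factorization.

(** * Linear spans *)

Section Span.
Variable k : fieldType.

Inductive span (U : lmodType k) (S : U -> Prop) : U -> Prop :=
| span0 : span S 0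
| span_step a x y of S x & span S y : span S (a *: x + y).

Lemma span_in (U : lmodType k) (S : U -> Prop) x : S x -> span S x.
Proof.
move=> Sx; rewrite -[x]addr0 -[x]scale1r; apply: span_step => //.
exact: span0.
Qed.

Lemma spanD (U : lmodType k) (S : U -> Prop) x y :
  span S x -> span S y -> span S (x + y).
Proof.
move=> + sy; elim=> [|a z w Sz _ IH]; first by rewrite add0r.
by rewrite -addrA; constructor.
Qed.

Lemma spanZ (U : lmodType k) (S : U -> Prop) a x : span S x -> span S (a *: x).
Proof.
elim=> [|b z w Sz _ IH]; first by rewrite scaler0; constructor.
by rewrite scalerDr scalerA; constructor.
Qed.

Lemma span_sum (U : lmodType k) (S : U -> Prop) (I : eqType) (r : seq I) F :
  (forall i, i \in r -> span S (F i)) -> span S (\sum_(i <- r) F i).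
Proof.
elim: r => [|i r IH] h; first by rewrite big_nil; constructor.
rewrite big_cons; apply: spanD; first by apply: h; rewrite inE eqxx.
by apply: IH => j jr; apply: h; rewrite inE jr orbT.
Qed.

Lemma span_map (U V : lmodType k) (S : U -> Prop) (S' : V -> Prop) (f : U -> V) x :
  linear f -> (forall y, S y -> span S' (f y)) -> span S x -> span S' (f x).
Proof.
move=> fL h; elim=> [|a y z Sy _ IH]; first by rewrite (lin0 fL); constructor.
by rewrite fL; apply: spanD => //; apply: spanZ; apply: h.
Qed.

Lemma span_trans (U : lmodType k) (S S' : U -> Prop) x :
  (forall y, S y -> span S' y) -> span S x -> span S' x.
Proof. by move=> h; apply: (@span_map U U S S' id) => //; move=> a y z. Qed.

Lemma span_linext (U : lmodType k) (K : choiceType) (F : K -> U) x :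
  span (fun y => exists u, y = F u) x -> exists c, x = linext F c.
Proof.
elim=> [|a y z [u ->] _ [c ->]].
  by exists 0; rewrite (lin0 (linext_is_linear F)).
by exists (a *: 'e_u + c); rewrite linext_is_linear linextU.
Qed.

Lemma linext_span (U : lmodType k) (K : choiceType) (F : K -> U) c :
  span (fun y => exists u, y = F u) (linext F c).
Proof.
by apply: span_sum => u _; apply/spanZ/span_in; exists u.
Qed.

End Span.

(** * Words in a Lie algebra mapping to an associative algebra *)

Section Words.
Variables (k : fieldType) (T : choiceType) (B : lmodType k).
Variables (mul : B -> B -> B) (one : B).
Variables (br : {malg k[T]} -> {malg k[T]} -> {malg k[T]}) (psi : {malg k[T]} -> B).
Hypotheses (alg : is_algebra mul one) (lie : is_lie_map br mul psi).
Implicit Types (w s : seq T) (x y : T).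

Definition word w : B := foldr (fun x b => mul (psi 'e_x) b) one w.

Let mulL b : linear (mul b).
Proof. by case: alg => -[]. Qed.

Let mulLr b : linear (mul^~ b).
Proof. by case: alg => -[]. Qed.

Let mA : associative mul.
Proof. by case: alg. Qed.

Lemma word_cat s w : word (s ++ w) = mul (word s) (word w).
Proof.
elim: s => [|x s IH] /=; first by case: alg => _ _ ->.
by rewrite IH mA.
Qed.

Definition shorter (m : nat) : B -> Prop :=
  span (fun b => exists2 w, (size w < m)%N & b = word w).

Lemma shorter_cons m x b : shorter m b -> shorter m.+1 (mul (psi 'e_x) b).
Proof.
apply: span_map (mulL _) _ => _ [w wm ->].
by apply: span_in; exists (x :: w).
Qed.

Lemma word_swap x y w :
  shorter (size w).+2 (word (x :: y :: w) - word (y :: x :: w)).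
Proof.
have -> : word (x :: y :: w) - word (y :: x :: w) =
    mul (psi (br 'e_x 'e_y)) (word w).
  rewrite lie.2 /= !mA; apply/esym; exact: (linB (mulLr _)).
have gL : linear (fun g => mul (psi g) (word w)).
  exact: (lin_comp (mulLr _) lie.1).
rewrite (linear_basisE (br 'e_x 'e_y) gL); apply: span_trans (linext_span _ _).
by move=> _ [z ->]; apply: span_in; exists (z :: w).
Qed.

Lemma word_move x s w :
  shorter (size (x :: s ++ w)) (word (x :: s ++ w) - word (s ++ x :: w)).
Proof.
elim: s => [|y s IH]; first by rewrite subrr; constructor.
have -> : word (x :: (y :: s) ++ w) - word ((y :: s) ++ x :: w) =
   (word (x :: y :: s ++ w) - word (y :: x :: s ++ w)) +
   mul (psi 'e_y) (word (x :: s ++ w) - word (s ++ x :: w)).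
  by rewrite (linB (mulL _)) addrA subrK.
by apply: spanD; [apply: word_swap | apply: shorter_cons].
Qed.

(** Commuting two letters costs a bracket, that is, shorter words. *)
Lemma word_perm s w : perm_eq s w -> shorter (size s) (word s - word w).
Proof.
elim: s w => [|x s IH] w sw.
  have /nilP -> : nilp w by rewrite /nilp -(perm_size sw).
  by rewrite subrr; constructor.
have xw : x \in w by rewrite -(perm_mem sw) inE eqxx.
have [w1 [w2 wE]] : exists w1 w2, w = w1 ++ x :: w2.
  by case/splitPr: xw => w1 w2; exists w1, w2.
have sw' : perm_eq s (w1 ++ w2).
  rewrite -(perm_cons x); apply: perm_trans sw _.
  by rewrite wE -[x :: w2]cat1s perm_catCA perm_refl.
rewrite wE.
have -> : word (x :: s) - word (w1 ++ x :: w2) =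
    mul (psi 'e_x) (word s - word (w1 ++ w2)) +
    (word (x :: w1 ++ w2) - word (w1 ++ x :: w2)).
  by rewrite (linB (mulL _)) addrA subrK.
apply: spanD; first exact/shorter_cons/IH.
have -> : size (x :: s) = size (x :: w1 ++ w2) by rewrite /= (perm_size sw').
exact: word_move.
Qed.

(** The spanning half of the Poincare-Birkhoff-Witt theorem: a word differs from
    its reordering by shorter words, which are handled by induction. *)
Lemma word_canonical (can : seq T -> seq T) s :
  (forall w, perm_eq w (can w)) ->
  span (fun b => exists w, b = word (can w)) (word s).
Proof.
move=> canP; elim/ltn_ind: {s}(size s) {-2}s (erefl (size s)) => m IH s sm.
rewrite -[word s](subrK (word (can s))); apply: spanD.
  apply: span_trans (word_perm (canP s)) => _ [w wm ->].
  by apply: (IH (size w)); rewrite // -sm.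
by apply: span_in; exists s.
Qed.

End Words.

Section WordMaps.
Variables (k : fieldType) (T : choiceType).

Lemma word_map (U V : lmodType k) (mulU : U -> U -> U) oneU (mulV : V -> V -> V) oneV
    (psi : {malg k[T]} -> U) (phi : {malg k[T]} -> V) (F : U -> V) w :
  (forall x y, F (mulU x y) = mulV (F x) (F y)) -> F oneU = oneV ->
  (forall x, F (psi x) = phi x) ->
  F (word mulU oneU psi w) = word mulV oneV phi w.
Proof. by move=> FM F1 Fp; elim: w => //= x w IH; rewrite FM Fp IH. Qed.

End WordMaps.

(** * The enveloping algebra *)

Section Enveloping.
Variables (k : fieldType) (n : nat) (q1 q2 : 'I_n -> k).
Variables (mul : Cdual k n -> Cdual k n -> Cdual k n).
Implicit Types u v : forest n.
Hypothesis mulE : forall f g u, (mul f g)@_u = conv q1 q2 f g (poset_of u).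

Local Notation one := (Dbasis k (fempty n)).
Local Notation bw := (biweight q1 q2).
Local Notation wordU := (word mul one (@incl k n)).

(** The leading term of a word.  Cutting a tree off a forest lowers the number of
    components by at most one, and by one only if the tree is a component.  Hence at
    a forest with at least as many components as the word has letters, only the
    ways to cut off the letters one after the other as components contribute, each
    with weight 1. *)
Lemma mcoeff_word ts : exists2 N, (0 < N)%N &
  forall u, (size ts <= nroots (poset_of u))%N ->
    (wordU ts)@_u = if u == tree_prod ts then N%:R else 0.
Proof.
elim: ts => [|t ts [N N0 IH]].
  exists 1%N => // u _; rewrite /= /Dbasis bvecE mcoeff_basis eq_sym.
  by case: eqP.
pose S u := [set A : {set poset_of u} | (cl A == forest_of_tree t) &&
                                        (cl (~: A) == tree_prod ts)].
have wE u : (size ts < nroots (poset_of u))%N ->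
    (wordU (t :: ts))@_u = (\sum_(A in S u) N%:R) /\
    (u != tree_prod (t :: ts) -> S u = set0).
  move=> su; have hP := poset_ofP u.
  have key (A : {set poset_of u}) : cl A = forest_of_tree t ->
      [/\ (size ts <= nroots (poset_of (cl (~: A))))%N &
          cl (~: A) = tree_prod ts -> unrelated A (~: A) /\ u = tree_prod (t :: ts)].
    move=> At; have [r hr] := tree_root hP At.
    have [le un] := remove_tree_roots hP hr; rewrite nroots_cl //; split.
      by rewrite -ltnS; apply: leq_trans su le.
    move=> Ats; have uA : unrelated A (~: A).
      by apply: un; rewrite -nroots_cl // Ats nroots_tree_prod.
    split=> //; rewrite /= -At -Ats -cl_setU //; last by rewrite -setI_eq0 setICr.
    by rewrite setUCr cl_setT // cls_poset.
  split; last first.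
    move=> une; apply/setP=> A; rewrite !inE; apply/negP=> /andP[/eqP At /eqP Ats].
    by have [_ /(_ Ats)[_ ue]] := key A At; rewrite ue eqxx in une.
  rewrite [LHS]/= mulE /conv [RHS]big_mkcond /=; apply: eq_bigr => A _.
  rewrite incl_basis mcoeff_basis inE eq_sym; case: eqP => [At|_] /=; last first.
    by rewrite mul0r mulr0.
  have [sA Aun] := key A At; rewrite IH // mul1r.
  case: eqP => [Ats|_]; last by rewrite mulr0.
  have [uA _] := Aun Ats.
  by rewrite biweight_unrelated // mul1r.
exists (#|S (tree_prod (t :: ts))| * N)%N.
  rewrite muln_gt0 N0 andbT; apply/card_gt0P.
  have [A At Ats] := funion_split (forest_of_tree t) (tree_prod ts).
  by exists A; rewrite inE At Ats !eqxx.
move=> u su; have [-> S0] := wE u su; case: eqP => [e|/eqP une]; last first.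
  by rewrite S0 // big_set0.
by rewrite sumr_const -mulrnA mulnC e.
Qed.

Section CharZero.
Hypothesis char0 : [pchar k] =i pred0.

Local Notation W := (fun u : forest n => wordU (factors u)).

Lemma nroots_factors u : size (factors u) = nroots (poset_of u).
Proof. by rewrite -{2}[u]factorsK nroots_tree_prod. Qed.

Lemma mcoeff_W u : exists2 N : k, N != 0 &
  forall v, (nroots (poset_of u) <= nroots (poset_of v))%N ->
    (W u)@_v = if v == u then N else 0.
Proof.
have [N N0 h] := mcoeff_word (factors u); exists N%:R.
  by have /pcharf0P -> := char0; rewrite -lt0n.
move=> v uv; rewrite -[X in v == X]factorsK; apply: h.
by rewrite nroots_factors.
Qed.

(** At a forest with the largest number of components in the support of [c], only
    one of the words contributes.  The induction on [j] goes down from the maximum. *)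
Lemma W_free (c : {malg k[forest n]}) : linext W c = 0 -> c = 0.
Proof.
move=> c0; pose nr (u : forest n) := nroots (poset_of u).
pose M := \max_(v <- msupp c) nr v.
have maxM v : v \in msupp c -> (nr v <= M)%N.
  by move=> vc; apply: (leq_bigmax_seq _ vc).
suff h j u : (M < nr u + j)%N -> c@_u = 0.
  apply/malgP=> u; rewrite mcoeff0; apply: (h M.+1).
  by rewrite addnS ltnS leq_addl.
elim: j u => [|j IH] u.
  rewrite addn0 => Mu; apply: mcoeff_outdom; apply/negP=> /maxM.
  by rewrite leqNgt Mu.
rewrite addnS ltnS leq_eqVlt => /orP[/eqP Mu|]; last exact: IH.
have [N N0 hN] := mcoeff_W u.
have : (linext W c)@_u = 0 by rewrite c0 mcoeff0.
have others v : v != u -> c@_v * (W v)@_u = 0.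
  move=> vu; have [vu'|uv] := leqP (nr v) (nr u); last first.
    by rewrite IH ?mul0r // Mu ltn_add2r.
  have [N' _ h'] := mcoeff_W v.
  by rewrite (h' u vu') eq_sym (negbTE vu) mulr0.
rewrite mcoeff_linext; case: (msuppP c u) => // uc.
rewrite (big_fsetD1 u uc) /= big1_fset => [|v]; last first.
  by rewrite in_fsetD1 => /andP[vu _] _; apply: others.
rewrite addr0 (hN u (leqnn _)) eqxx => /eqP.
by rewrite mulf_eq0 (negbTE N0) orbF => /eqP.
Qed.

Lemma W_inj : injective (linext W).
Proof.
move=> c d /eqP; rewrite -subr_eq0 -(linB (linext_is_linear W)) => /eqP /W_free.
by move/eqP; rewrite subr_eq0 => /eqP.
Qed.

(** By [mcoeff_W], ['e_u] is a multiple of [W u] up to forests with fewer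
    components. *)
Lemma W_span_basis u : span (fun y => exists v, y = W v) 'e_u.
Proof.
elim/ltn_ind: {u}(nroots (poset_of u)) {-2}u (erefl (nroots (poset_of u))) => m IH u um.
have [N N0 hN] := mcoeff_W u.
have Wu : W u = N *: 'e_u + (W u - N *: 'e_u) by rewrite addrC subrK.
have -> : 'e_u = N^-1 *: (W u - (W u - N *: 'e_u)).
  by rewrite opprB addrC subrK scalerA mulVf // scale1r.
apply/spanZ/spanD; first by apply: span_in; exists u.
rewrite -scaleN1r; apply: spanZ; rewrite [X in span _ X]malg_basisE.
apply: span_sum => v; rewrite -mcoeff_neq0 mcoeffB mcoeffZ mcoeff_basis => vn.
apply: spanZ; apply: (IH (nroots (poset_of v))) => //; rewrite -um ltnNge.
apply: contra vn => uv; rewrite (hN v uv) (eq_sym u v).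
by case: ifP; rewrite ?mulr1 ?mulr0 subrr.
Qed.

Lemma W_surj f : exists c, linext W c == f.
Proof.
suff /span_linext[c ->] : span (fun y => exists v, y = W v) f by exists c.
rewrite [f]malg_basisE; apply: span_sum => u _; apply: spanZ.
exact: W_span_basis.
Qed.

Definition coordW f : {malg k[forest n]} := xchoose (W_surj f).

Lemma coordWK f : linext W (coordW f) = f.
Proof. exact/eqP/(xchooseP (W_surj f)). Qed.

Lemma linextWK c : coordW (linext W c) = c.
Proof. by apply: W_inj; rewrite coordWK. Qed.

Lemma coordW_linear : linear coordW.
Proof. by move=> a f g; apply: W_inj; rewrite linext_is_linear !coordWK. Qed.

Section Universal.
Variables (A : algType k) (phi : treeL k n -> A).
Hypothesis lie : is_lie_map (bracket q1 q2) *%R phi.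

Local Notation wordA := (word *%R 1 phi).

Definition extend f : A := linext (fun u => wordA (factors u)) (coordW f).

Lemma extend_linear : linear extend.
Proof. exact: lin_comp (linext_is_linear _) coordW_linear. Qed.

Lemma A_algebra : is_algebra ( *%R : A -> A -> A) 1.
Proof.
split; [split=> v a x y|exact: mulrA|exact: mul1r|exact: mulr1].
  by rewrite mulrDl -scalerAl.
by rewrite mulrDr -scalerAr.
Qed.

(** The words in the pairs of [incl x] and [phi x] are combinations of those with
    ordered letters.  As the first components of the latter are linearly
    independent, the second component of a word is determined by the first. *)
Lemma extend_word ts : extend (wordU ts) = wordA ts.
Proof.
have [[mL mR] mA m1l m1r] := dual_algebra mulE.
have [inclL inclB] := incl_lie_map mulE.
pose mulB (x y : (Cdual k n * A)%type) : (Cdual k n * A)%type :=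
  (mul x.1 y.1, x.2 * y.2).
pose oneB : (Cdual k n * A)%type := (one, 1).
pose psi (x : treeL k n) : (Cdual k n * A)%type := (incl x, phi x).
have algB : is_algebra mulB oneB.
  have [[aL aR] _ _ _] := A_algebra.
  split; [split=> v a x y|move=> x y z|move=> [x y]|move=> [x y]].
  - by congr pair; [apply: mL | apply: aL].
  - by congr pair; [apply: mR | apply: aR].
  - by congr pair; [apply: mA | apply: mulrA].
  - by congr pair; [apply: m1l | apply: mul1r].
  - by congr pair; [apply: m1r | apply: mulr1].
have lieB : is_lie_map (bracket q1 q2) mulB psi.
  split=> [a x y|x y]; first by congr pair; [apply: inclL | apply: lie.1].
  by congr pair; [apply: inclB | apply: lie.2].
have w1 s : (word mulB oneB psi s).1 = wordU s by apply: word_map.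
have w2 s : (word mulB oneB psi s).2 = wordA s by apply: word_map.
have : span (fun b => exists u, b = word mulB oneB psi (factors u))
    (word mulB oneB psi ts).
  apply: span_trans (word_canonical algB lieB ts (@perm_factors n)) => _ [w ->].
  by apply: span_in; exists (tree_prod w).
case/span_linext=> c wc.
have c1 : wordU ts = linext W c.
  rewrite -w1 wc (linear_basisE (f := fun c => (linext _ c).1)).
    by apply: eq_bigr => u _; rewrite linextU w1.
  by move=> a x y; rewrite linext_is_linear.
have c2 : wordA ts = linext (fun u => wordA (factors u)) c.
  rewrite -w2 wc (linear_basisE (f := fun c => (linext _ c).2)).
    by apply: eq_bigr => u _; rewrite linextU w2.
  by move=> a x y; rewrite linext_is_linear.
by rewrite /extend c1 linextWK -c2.
Qed.

Lemma extend_algebra_map : is_algebra_map mul one extend.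
Proof.
have [[mL mR] _ _ _] := dual_algebra mulE; have [[aL aR] _ _ _] := A_algebra.
split; [exact: extend_linear | | exact: (extend_word [::])].
move=> f g; rewrite -[f]coordWK -[g]coordWK; move: (coordW f) (coordW g) => {f g} c d.
have WL := linext_is_linear W; have EL := extend_linear.
move: c; apply: linear_basis_eq.
- exact: (lin_comp EL (lin_comp (mL _) WL)).
- exact: (lin_comp (aL _) (lin_comp EL WL)).
move=> u; move: d; apply: linear_basis_eq.
- exact: (lin_comp EL (lin_comp (mR _) WL)).
- exact: (lin_comp (aR _) (lin_comp EL WL)).
move=> v; rewrite !linextU -(word_cat (@incl k n) (dual_algebra mulE)).
apply: etrans (extend_word _) _; apply: etrans (word_cat phi A_algebra _ _) _.
exact: (esym (congr2 *%R (extend_word (factors u)) (extend_word (factors v)))).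
Qed.

Lemma extend_incl x : extend (incl x) = phi x.
Proof.
have [_ _ _ m1r] := dual_algebra mulE.
move: x; apply: linear_basis_eq; [|exact: lie.1|].
  exact: (lin_comp extend_linear (@incl_linear k n)).
by move=> t; have := extend_word [:: t]; rewrite /= m1r mulr1.
Qed.

Lemma extend_uniq (Psi : Cdual k n -> A) :
  is_algebra_map mul one Psi -> (forall x, Psi (incl x) = phi x) -> Psi =1 extend.
Proof.
case=> PL PM P1 Pi f; rewrite -[f]coordWK; move: (coordW f).
have WL := linext_is_linear W.
apply: linear_basis_eq; first exact: (lin_comp PL WL).
  exact: (lin_comp extend_linear WL).
by move=> u; rewrite linextU extend_word; apply: word_map.
Qed.

End Universal.

Lemma dual_is_enveloping :
  is_enveloping_algebra (bracket q1 q2) mul one (@incl k n).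
Proof.
split; [exact: dual_algebra mulE | exact: incl_lie_map mulE | move=> A phi lie].
exists (extend phi); split; [exact: extend_algebra_map | exact: extend_incl |].
exact: extend_uniq.
Qed.

End CharZero.
End Enveloping.

(* The universal property is restricted to characteristic 0: if k has
   characteristic p > 0, then D_u, for u the forest of p isolated vertices, is
   not in the subalgebra generated by the D_t, since D_t1 ... D_tm takes the
   value p! = 0 on u when m = p and all t_i are one-vertex trees, and 0
   otherwise. *)
Theorem corollary6p7 (k : fieldType) (n : nat) (q1 q2 : 'I_n -> k) :
  (exists (Delta : {lrmorphism Ctrees k n -> Ctrees2 k n})
          (mul : Cdual k n -> Cdual k n -> Cdual k n),
     is_coproduct q1 q2 Delta /\ is_dual_product Delta mul) /\
  forall (Delta : {lrmorphism Ctrees k n -> Ctrees2 k n})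
         (mul : Cdual k n -> Cdual k n -> Cdual k n),
    is_coproduct q1 q2 Delta -> is_dual_product Delta mul ->
    [/\ is_lie_algebra (bracket q1 q2),
        is_algebra mul (Dbasis k (fempty n)),
        is_lie_map (bracket q1 q2) mul (@incl k n),
        forall x : treeL k n, is_primitive (incl x)
      & [pchar k] =i pred0 ->
        is_enveloping_algebra (bracket q1 q2) mul (Dbasis k (fempty n))
          (@incl k n)].
Proof.
split.
  exists (Delta q1 q2), (dual_mul q1 q2); split; first exact: Delta_is_coproduct.
  exact: dual_mul_is_dual.
move=> D mul cD dm.
have mulE f g u : (mul f g)@_u = conv q1 q2 f g (poset_of u).
  rewrite -pairing_bvec dm (coproduct_uniq cD) Delta_basis.
  exact: pairing2_cop.
split; [exact: tree_lie_algebra mulE | exact: dual_algebra mulE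
       | exact: incl_lie_map mulE | exact: incl_primitive |].
exact: dual_is_enveloping.
Qed.
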